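(* Let $\Bbbk$ be a field and let $A=(A,d,\cdot\,)$ be a differential graded associative $\Bbbk$-algebra with cohomology $H=H(A,d)$. Then $A$ admits a canonical minimal model, i.e. there exist an $A_\infty$-structure $(H,0,\mu_2,\mu_3,\ldots)$ on $H$ and an $A_\infty$-morphism $$\psi_\infty=(\psi,\psi_2,\psi_3,\ldots):(H,0,\mu_2,\mu_3,\ldots)\longrightarrow (A,d,\cdot\,,0,0,\ldots)$$ such that $[\psi(h)]=h$ for each $h\in H$. Moreover, the canonical minimal model is unique up to isotopy: for any two canonical minimal models $(H,0,\mu_2',\mu_3',\ldots)$ and $(H,0,\mu_2'',\mu_3'',\ldots)$ of $A$ there exists an isotopy $(H,0,\mu_2',\mu_3',\ldots)\to(H,0,\mu_2'',\mu_3'',\ldots)$, that is, an $A_\infty$-morphism whose linear part is the identity $\mathrm{id}_H$.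
   Context: All objects are over a field $\Bbbk$; complexes are cochain complexes (differentials of degree $+1$), possibly unbounded; $[a]$ denotes the cohomology class of a cocycle $a$. Koszul sign rule is used when evaluating tensor products of maps on elements. An $A_\infty$-algebra $(A,d,\mu_2,\mu_3,\ldots)$ is a cochain complex $(A,d)$ with linear maps $\mu_n:A^{\otimes n}\to A$ of degree $2-n$, $n\ge2$, such that for all $n\ge 2$ $$\delta(\mu_n)=\sum (-1)^{i(l+1)+n}\,\mu_k\big(\mathrm{id}^{\otimes (i-1)}\otimes\mu_l\otimes \mathrm{id}^{\otimes (k-i)}\big),$$ the sum over $k,l\ge2$, $k+l=n+1$, $1\le i\le k$, where $\delta(f)=d\circ f-(-1)^{|f|}f\circ d$ is the induced differential on multilinear maps. A differential graded associative algebra $(A,d,\cdot\,)$ is viewed as the $A_\infty$-algebra with $\mu_2=\cdot$ and $\mu_n=0$ for $n\ge3$. An $A_\infty$-morphism $\vartheta_\infty=(\vartheta,\vartheta_2,\vartheta_3,\ldots):(A,d,\mu_2,\mu_3,\ldots)\to(B,d,\nu_2,\nu_3,\ldots)$ consists of a cochain map $\vartheta=\vartheta_1:A\to B$ (its linear part) and linear maps $\vartheta_n:A^{\otimes n}\to B$ of degree $1-n$, $n\ge2$, such that for all $n\ge2$ $$\delta(\vartheta_n)+\sum_{k\ge2,\ r_1+\cdots+r_k=n,\ r_j\ge1}(-1)^{\sum_{i<j}r_i(r_j+1)}\nu_k(\vartheta_{r_1}\otimes\cdots\otimes\vartheta_{r_k})=\vartheta\circ\mu_n-\sum(-1)^{i(l+1)+n}\vartheta_k\big(\mathrm{id}^{\otimes(i-1)}\otimes\mu_l\otimes\mathrm{id}^{\otimes(k-i)}\big),$$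 the last sum over $k,l\ge2$, $k+l=n+1$, $1\le i\le k$. An isotopy is an $A_\infty$-morphism whose linear part is the identity automorphism of the underlying cochain complex. A canonical minimal model of a dg algebra $A$ with cohomology $H=H(A,d)$ is an $A_\infty$-structure $(H,0,\mu_2,\mu_3,\ldots)$ on $H$ with zero differential for which there exists an associated connecting $A_\infty$-morphism $\psi_\infty=(\psi,\psi_2,\ldots):(H,0,\mu_2,\mu_3,\ldots)\to(A,d,\cdot\,,0,0,\ldots)$ such that $\psi$ sends each $h\in H$ to a cocycle representing it, i.e. $[\psi(h)]=h$. *)

(* Defs.v *)
From HB Require Import structures.
From mathcomp Require Import all_boot all_order all_algebra.
From mathcomp Require Import boolp zify.

Set Implicit Arguments.
Unset Strict Implicit.
Unset Printing Implicit Defensive.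

Import GRing.Theory.
Local Open Scope quotient_scope.
Local Open Scope ring_scope.

Notation graded k := (int -> lmodType k).

Section Homogeneous.
Variables (k : fieldType) (V : graded k).

Definition homog := {i : int & V i}.

Definition hmk (i : int) (x : V i) : homog := Tagged (fun i => V i) x.

(** The component of x in degree e: x itself, transported, if |x| = e, else 0. *)
Definition component (x : homog) (e : int) : V e :=
  @untag _ (fun i => V i) (V e) 0 e id x.

Definition degs (s : seq homog) : int := \sum_(x <- s) tag x.

End Homogeneous.

(** A family of multilinear maps f_n : V^{(x) n} -> W of degree p(n), one for
    each n, given by its values on homogeneous elements: for s of size n,
    [f s e] is the component in W^e of f_n(s_1, ..., s_n).  Indexing the values
    by the target degree e avoids transports between degrees that are only
    provably equal; by [opsP] only the component e = |s_1| + ... + |s_n| + p(n)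
    can be nonzero.  The structures below never use the value at n = 0. *)
Record ops (k : fieldType) (p : nat -> int) (V W : graded k) := Ops {
  ops_fun :> seq (homog V) -> forall e, W e;
  ops_linear : forall s1 s2 i (a : k) (x y : V i) e,
    ops_fun (s1 ++ hmk (a *: x + y) :: s2) e =
      a *: ops_fun (s1 ++ hmk x :: s2) e + ops_fun (s1 ++ hmk y :: s2) e;
  opsP : forall s e, e != degs s + p (size s) -> ops_fun s e = 0 }.

Definition ops_val (k : fieldType) (p : nat -> int) (V W : graded k)
    (f : ops p V W) (s : seq (homog V)) : homog W :=
  hmk (f s (degs s + p (size s))).

Record complex (k : fieldType) := Complex {
  cpx :> graded k;
  diff : forall i, {linear cpx i -> cpx (i + 1)};
  diffK : forall i (x : cpx i), diff (i + 1) (diff i x) = 0 }.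

Arguments diff {k} c i.

Definition hdiff (k : fieldType) (C : complex k) (x : homog C) : homog C :=
  hmk (diff C (tag x) (tagged x)).

(** The differential delta(f) = d o f - (-1)^|f| f o d, evaluated on s, in
    degree e + 1.  The sign (-1)^(degs (take j s)) is the Koszul sign of
    id^{(x) j} (x) d (x) id^{(x) (n - j - 1)}. *)
Definition delta (k : fieldType) (p : nat -> int) (C D : complex k)
    (f : ops p C D) (s : seq (homog C)) (e : int) : D (e + 1) :=
  diff D e (f s e)
  - (-1) ^ p (size s) *:
    \sum_(j < size s) (-1) ^ degs (take j s) *:
      f (take j s ++ hdiff (tnth (in_tuple s) j) :: drop j.+1 s) (e + 1).

(** The sum over k, l >= 2, k + l = n + 1 and 1 <= i <= k of
      (-1)^(i(l+1)+n) f_k (id^{(x) (i-1)} (x) g_l (x) id^{(x) (k-i)}),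
    evaluated on s of size n; the second sign is the Koszul sign of moving g_l,
    which has degree q(l), past the first i - 1 entries. *)
Definition insertion_sum (k : fieldType) (p q : nat -> int) (V W : graded k)
    (f : ops p V W) (g : ops q V V) (s : seq (homog V)) (e : int) : W e :=
  let n := size s in
  \sum_(2 <= m < n.+1) \sum_(2 <= l < n.+1 | (m + l == n.+1)%N)
    \sum_(1 <= i < m.+1)
      let s1 := take i.-1 s in
      let s2 := take l (drop i.-1 s) in
      let s3 := drop (i.-1 + l) s in
      (-1) ^+ (i * l.+1 + n) *: ((-1) ^ (q l * degs s1) *:
        f (s1 ++ ops_val g s2 :: s3) e).

(** The sum over m >= 2 and r_1 + ... + r_m = n with r_j >= 1 of
      (-1)^(sum_(i<j) r_i (r_j + 1)) g_m (f_{r_1} (x) ... (x) f_{r_m}),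
    evaluated on s of size n; [reshape] cuts s into consecutive blocks of sizes
    r_1, ..., r_m.  The second sign is the Koszul sign of moving each f_{r_j}
    past the blocks to its left. *)
Definition composition_sum (k : fieldType) (p q : nat -> int)
    (V W X : graded k) (g : ops q W X) (f : ops p V W)
    (s : seq (homog V)) (e : int) : X e :=
  let n := size s in
  \sum_(2 <= m < n.+1)
    \sum_(r : m.-tuple 'I_n.+1 |
            [forall j, 0 < tnth r j]%N && (\sum_(j < m) tnth r j == n)%N)
      let blocks := reshape [seq nat_of_ord x | x <- r] s in
      (-1) ^+ (\sum_(j < m) \sum_(i < m | (i < j)%N)
                  tnth r i * (tnth r j).+1)%N *:
      ((-1) ^ (\sum_(j < m) \sum_(i < m | (i < j)%N)
                  p (tnth r j) * degs (nth [::] blocks i)) *: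
        g [seq ops_val f b | b <- blocks] e).

Definition mu_deg (n : nat) : int := 2 - n%:Z.
Definition theta_deg (n : nat) : int := 1 - n%:Z.

(** An A-infinity structure on the complex C.  The operation mu_n is the
    restriction of [mu] to sequences of size n; only n >= 2 is meaningful. *)
Record ainf (k : fieldType) (C : complex k) := Ainf {
  mu :> ops mu_deg C C;
  ainfP : forall s e, (2 <= size s)%N ->
    delta mu s e = insertion_sum mu mu s (e + 1) }.

Definition linear_part (k : fieldType) (V W : graded k) (f : ops theta_deg V W)
    (i : int) (x : V i) : W i := f [:: hmk x] i.

(** theta_n is the restriction of [theta] to sequences of size n >= 1. *)
Record ainf_morphism (k : fieldType) (C D : complex k)
    (M : ainf C) (N : ainf D) := AinfMorphism {
  theta :> ops theta_deg C D;
  theta1P : forall i (x : C i),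
    diff D i (linear_part theta x) = linear_part theta (diff C i x);
  thetaP : forall s e, (2 <= size s)%N ->
    delta theta s e + composition_sum N theta s (e + 1) =
      theta [:: ops_val M s] (e + 1) - insertion_sum theta M s (e + 1) }.

Definition isotopy (k : fieldType) (C : complex k) (M N : ainf C)
    (f : ainf_morphism M N) : Prop :=
  forall i (x : C i), linear_part f x = x.

(** No unit is required.  [dmulA] equates elements of degrees i + (j + l) and
    (i + j) + l, hence lives in the type of homogeneous elements; in
    [dmul_leibniz] both summands have degree i + j + 1 up to a provable equality
    and [component] transports them there. *)
Record dga (k : fieldType) := Dga {
  dga_complex :> complex k;
  dmul : forall i j, dga_complex i -> dga_complex j -> dga_complex (i + j);
  dmul_linearl : forall i j (a : k) (x y : dga_complex i) (z : dga_complex j),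
    dmul (a *: x + y) z = a *: dmul x z + dmul y z;
  dmul_linearr : forall i j (a : k) (x : dga_complex i) (y z : dga_complex j),
    dmul x (a *: y + z) = a *: dmul x y + dmul x z;
  dmulA : forall i j l (x : dga_complex i) (y : dga_complex j)
      (z : dga_complex l),
    hmk (dmul x (dmul y z)) = hmk (dmul (dmul x y) z);
  dmul_leibniz : forall i j (x : dga_complex i) (y : dga_complex j),
    diff dga_complex (i + j) (dmul x y) =
      component (hmk (dmul (diff dga_complex i x) y)) (i + j + 1)
      + (-1) ^ i *:
        component (hmk (dmul x (diff dga_complex j y))) (i + j + 1) }.

Section ComponentTheory.
Variables (k : fieldType) (V : graded k).

Lemma component_id i (x : V i) : component (hmk x) i = x.
Proof. by rewrite /component (untagE _ _ (erefl : tag (hmk x) = i)). Qed.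

Lemma component_neq (x : homog V) e : tag x != e -> component x e = 0.
Proof. exact: untag_dflt. Qed.

Lemma component_linear i (a : k) (x y : V i) e :
  component (hmk (a *: x + y)) e =
    a *: component (hmk x) e + component (hmk y) e.
Proof.
have [<-|ne] := eqVneq i e; first by rewrite !component_id.
by rewrite !component_neq // scaler0 addr0.
Qed.

End ComponentTheory.

Section DgaAinf.
Variables (k : fieldType) (A : dga k).

Definition dga_mu_fun (s : seq (homog A)) (e : int) : A e :=
  if s is [:: x; y] then component (hmk (dmul (tagged x) (tagged y))) e else 0.

Lemma dga_mu_linear s1 s2 i (a : k) (x y : A i) e :
  dga_mu_fun (s1 ++ hmk (a *: x + y) :: s2) e =
    a *: dga_mu_fun (s1 ++ hmk x :: s2) e + dga_mu_fun (s1 ++ hmk y :: s2) e.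
Proof.
case: s1 => [|u [|v [|w s1]]] /=; last by rewrite scaler0 addr0.
- case: s2 => [|v [|w s2]] /=; rewrite ?scaler0 ?addr0 //.
  by rewrite dmul_linearl component_linear.
- case: s2 => [|v s2] /=; rewrite ?scaler0 ?addr0 //.
  by rewrite dmul_linearr component_linear.
- by rewrite scaler0 addr0.
Qed.

Lemma dga_muP s e : e != degs s + mu_deg (size s) -> dga_mu_fun s e = 0.
Proof.
case: s => [|x [|y [|z s]]] //=.
rewrite /degs !big_cons big_nil /mu_deg subrr !addr0 eq_sym => ne.
exact: component_neq.
Qed.

Definition dga_mu : ops mu_deg A A := Ops dga_mu_linear dga_muP.

Lemma dga_mu_neq2 s e : size s != 2%N -> dga_mu s e = 0.
Proof. by case: s => [|x [|y [|z s]]]. Qed.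

Lemma dga_mu_hmk0 s1 s2 i e : dga_mu (s1 ++ hmk (0 : A i) :: s2) e = 0.
Proof.
have /eqP := ops_linear dga_mu s1 s2 1 (0 : A i) 0 e.
by rewrite !scale1r addr0 -subr_eq subrr eq_sym => /eqP.
Qed.

Lemma dga_delta0 s e : size s != 2%N -> delta dga_mu s e = 0.
Proof.
move=> s2; rewrite /delta dga_mu_neq2 // linear0 big1 ?scaler0 ?subr0 // => j _.
rewrite dga_mu_neq2 ?scaler0 //.
rewrite size_cat /= size_takel ?size_drop; last exact: ltnW.
by rewrite addnS -addSn subnKC.
Qed.

Lemma dga_insertion0 s e : size s != 3%N ->
  insertion_sum dga_mu dga_mu s e = 0.
Proof.
move=> s3; apply: big1_seq => m /andP[_]; rewrite mem_index_iota => /andP[m2 _].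
apply: big1_seq => l /andP[/eqP ml]; rewrite mem_index_iota => /andP[l2 _].
apply: big1_seq => i /andP[_]; rewrite mem_index_iota ltnS => /andP[i1 im].
have [l_2|l_n2] := eqVneq l 2%N; last first.
  rewrite /ops_val [dga_mu (take _ _) _]dga_mu_neq2 ?dga_mu_hmk0 ?scaler0 //.
  rewrite size_takel // size_drop leq_subRL; lia.
rewrite /ops_val [dga_mu (_ ++ _) _]dga_mu_neq2 ?scaler0 //.
rewrite size_cat /= size_takel ?size_drop; lia.
Qed.

Lemma dga_ainfP s e : (2 <= size s)%N ->
  delta dga_mu s e = insertion_sum dga_mu dga_mu s (e + 1).
Proof.
have degs2 (u v : homog A) : degs [:: u; v] = tag u + tag v.
  by rewrite /degs !big_cons big_nil addr0.
case: s => [|x [|y [|z [|t s]]]] // _.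
- rewrite dga_insertion0 // /delta /= !big_ord_recl big_ord0 addr0.
  rewrite (tnth_nth x) [tnth _ (lift _ _)](tnth_nth x) /= /degs.
  rewrite big_nil big_cons big_nil addr0.
  rewrite /mu_deg subrr !expr0z !scale1r.
  case: x y => [i x] [j y] /=; rewrite /hdiff /hmk /=.
  have [<-|ne] := eqVneq (i + j) e.
    by rewrite [component _ (i + j)]component_id dmul_leibniz subrr.
  rewrite [component _ e]component_neq // linear0.
  rewrite !component_neq ?scaler0 ?addr0 ?subr0 //=.
    by apply: contra ne => /eqP/esym; rewrite addrA => /addIr->.
  by apply: contra ne => /eqP/esym; rewrite addrAC => /addIr->.
- rewrite dga_delta0 // /insertion_sum.
  rewrite /index_iota /= !big_cons !big_nil /=.
  rewrite /mu_deg subrr !mul0r !expr0z !scale1r !addr0.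
  rewrite -signr_odd /= expr0 -signr_odd /= expr1 scale1r scaleN1r.
  case: x y z => [i x] [j y] [l z] /=; rewrite !degs2.
  rewrite [component _ (i + j)]component_id.
  by rewrite [component _ (j + l)]component_id dmulA subrr.
- by rewrite dga_delta0 // dga_insertion0.
Qed.

Definition dga_ainf : ainf A := Ainf dga_ainfP.

End DgaAinf.

Section Cohomology.
Variables (k : fieldType) (C : complex k) (i : int).

Definition cocycle_pred : {pred C i} := fun x => diff C i x == 0.

Lemma cocycle_submod : submod_closed cocycle_pred.
Proof.
split; rewrite /cocycle_pred; first by rewrite unfold_in linear0.
move=> a x y; rewrite !unfold_in linearP => /eqP-> /eqP->.
by rewrite scaler0 addr0.
Qed.

HB.instance Definition _ :=
  GRing.isSubmodClosed.Build k (C i) cocycle_pred cocycle_submod.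

Record cocycle := Cocycle {
  cocycle_val :> C i;
  cocycle_valP : cocycle_val \in cocycle_pred }.

HB.instance Definition _ := [isSub for cocycle_val].
HB.instance Definition _ := [Choice of cocycle by <:].
HB.instance Definition _ := [SubChoice_isSubLmodule of cocycle by <:].

(** [hmk x = hmk (d y)] says that x is d y; it forces j + 1 = i. *)
Definition coboundary_pred : {pred cocycle} := fun x =>
  `[< exists j (y : C j), hmk (cocycle_val x) = hmk (diff C j y) >].

Lemma cocycle_val0 : cocycle_val 0 = 0.
Proof. exact: (raddf0 (\val : cocycle -> C i)). Qed.

Lemma cocycle_val_linear a x y :
  cocycle_val (a *: x + y) = a *: cocycle_val x + cocycle_val y.
Proof. exact: (linearP (\val : cocycle -> C i)). Qed.

Lemma coboundary_submod : submod_closed coboundary_pred.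
Proof.
split; rewrite /coboundary_pred.
  apply/asboolP; exists (i - 1), 0; rewrite linear0 cocycle_val0.
  by have -> : i - 1 + 1 = i by rewrite subrK.
move=> a x y /asboolP[j [u xu]] /asboolP[l [v yv]]; apply/asboolP.
have ij : i = j + 1 := congr1 tag xu.
have jl : j = l by apply: (addIr 1); rewrite -ij; exact: (congr1 tag yv).
case: l / jl v yv => v yv; exists j, (a *: u + v).
rewrite linearP cocycle_val_linear; move: (cocycle_val x) (cocycle_val y) xu yv.
rewrite ij => x' y' xu yv.
by rewrite -(component_id x') -(component_id y') xu yv !component_id.
Qed.

HB.instance Definition _ :=
  GRing.isSubmodClosed.Build k cocycle coboundary_pred coboundary_submod.

Definition cohomology := Quotient.quot coboundary_pred.

HB.instance Definition _ := GRing.Zmodule.on cohomology.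

Definition coho_class (z : cocycle) : cohomology :=
  \pi_(Quotient.quot coboundary_pred) z.

Definition coho_scale (a : k) (h : cohomology) : cohomology :=
  coho_class (a *: repr h).

Lemma coho_classD z w : coho_class (z + w) = coho_class z + coho_class w.
Proof. exact: (raddfD (\pi_(Quotient.quot coboundary_pred))). Qed.

Lemma coho_classP z w : coho_class z = coho_class w <-> z - w \in coboundary_pred.
Proof. by rewrite Quotient.idealrBE; exact: (rwP eqP). Qed.

Lemma coho_classZ a z : coho_class (a *: z) = coho_scale a (coho_class z).
Proof.
apply/coho_classP; rewrite -scalerBr rpredZ //.
by apply/coho_classP; rewrite /coho_class reprK.
Qed.

Lemma coho_class_ind (P : cohomology -> Prop) :
  (forall z, P (coho_class z)) -> forall h, P h.
Proof. by move=> Pz h; rewrite -[h]reprK; exact: Pz. Qed.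

Lemma coho_scaleA a b h : coho_scale a (coho_scale b h) = coho_scale (a * b) h.
Proof.
by elim/coho_class_ind: h => z; rewrite -!coho_classZ scalerA.
Qed.

Lemma coho_scale1 : left_id 1 coho_scale.
Proof. by elim/coho_class_ind => z; rewrite -coho_classZ scale1r. Qed.

Lemma coho_scaleDr : right_distributive coho_scale +%R.
Proof.
move=> a; elim/coho_class_ind => z; elim/coho_class_ind => w.
by rewrite -coho_classD -!coho_classZ scalerDr coho_classD.
Qed.

Lemma coho_scaleDl h : {morph coho_scale^~ h : a b / a + b}.
Proof.
elim/coho_class_ind: h => z a b.
by rewrite -!coho_classZ scalerDl coho_classD.
Qed.

HB.instance Definition _ := GRing.Zmodule_isLmodule.Build k cohomology
  coho_scaleA coho_scale1 coho_scaleDr coho_scaleDl.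

End Cohomology.

Section CohomologyComplex.
Variables (k : fieldType) (C : complex k).

Definition coho : int -> lmodType k := fun i => cohomology C i.

Definition coho_diff (i : int) : {linear coho i -> coho (i + 1)} := \0.

Lemma coho_diffK i (h : coho i) : coho_diff (i + 1) (coho_diff i h) = 0.
Proof. by []. Qed.

Definition coho_complex : complex k := Complex coho_diffK.

End CohomologyComplex.

Definition represents (k : fieldType) (C : complex k) (i : int)
    (x : C i) (h : coho_complex C i) : Prop :=
  exists2 z : cocycle C i, cocycle_val z = x & coho_class z = h.

Definition canonical_minimal_model (k : fieldType) (A : dga k)
    (M : ainf (coho_complex A)) : Prop :=
  exists psi : ainf_morphism M (dga_ainf A),
    forall i (h : coho_complex A i), represents (linear_part psi h) h.

(* Main.v *)
(** A morphism from an A-infinity structure on H to the dg algebra A is, after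
    desuspension (the bar construction), a twisting cochain f on the words in H
    with values in A: d f = f o D - (eps f) * f, where D is the coderivation
    given by the operations and * the convolution product.  The operations and
    f are built by induction on the word length: the right-hand side of the
    equation in the next arity has differential f_1(relation), so, f_1 being
    injective on cohomology, the A-infinity relation holds and the right-hand
    side is a cocycle; its class is absorbed into the new operation and a
    homotopy for d gives the new component of f.

    For uniqueness, an isotopy t : H' -> H'' is built together with a homotopy
    eta from f' to f'' o t.  In the convolution algebra this homotopy is a gauge
    equivalence 1 + eta, an equation linear in eta, and the same obstruction
    argument applies: the differential of its right-hand side in the next arity
    is - f''_1(defect of t). *)

From HB Require Import structures.
Require Import Defs.
From mathcomp Require Import all_boot all_algebra.
From mathcomp Require Import boolp classical_sets zify ring.

Set Implicit Arguments.
Unset Strict Implicit.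
Unset Printing Implicit Defensive.

Import GRing.Theory.
Local Open Scope ring_scope.

(** Each arity can be solved on its own because the right-hand side in arity n + 1 does not contain
    the component of f being sought: H has zero differential, so insertions contract blocks of
    length at least two, and f vanishes on the empty word, so both factors of a convolution product
    are proper subwords. The same is true of eta, and the defect of t in arity n + 1 sees t only up
    to length n. The ground field enters through linear splittings: a projection p of cochains onto
    cohomology extending the class map, and a map h with d h d = d. Injectivity of f_1 on cohomology
    is used in the form p f_1 = id together with p d = 0. A need not have a unit, so the 1 in 1 +
    eta is formal and its contributions - tau and + rho are written out in [gauge]. Degrees and
    signs are tamed by two devices. Maps on words take values in the product [tot] of all degrees,
    where equations need no transports, and [supp] records the degree. Multiplying an operation by
    the sign with exponent [kappa] reduces the signs of the A-infinity relations to [eps]. *)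

(** * Linear selections and quasi-inverses by Zorn's lemma *)

Section LinearSelection.
Variables (k : fieldType) (V U : lmodType k) (R : V -> U -> Prop).
Hypothesis R_linear : forall a v u v' u',
  R v u -> R v' u' -> R (a *: v + v') (a *: u + u').

(** Graphs of partial linear maps, so that a chain is joined by a union. The value is constrained by
    [R] only where [R] has some value at all; elsewhere it is free. *)
Let admissible (G : set (V * U)) : Prop :=
  [/\ forall a p q, G p -> G q -> G (a *: p + q),
      forall u, G (0, u) -> u = 0
    & forall v u w, G (v, u) -> R v w -> R v u].

Let admissible_bigcup (F : set (set (V * U))) :
  (F `<=` admissible)%classic -> total_on F subset ->
  admissible (\bigcup_(X in F) X)%classic.
Proof.
move=> Fadm Ftot; split.
- move=> a p q [X FX Xp] [Y FY Yq].
  have [XY|YX] := Ftot X Y FX FY.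
    by exists Y => //; have [lin _ _] := Fadm Y FY; apply: lin => //; exact: XY.
  by exists X => //; have [lin _ _] := Fadm X FX; apply: lin => //; exact: YX.
- by move=> u [X FX]; have [_ + _] := Fadm X FX; exact.
- by move=> v u w [X FX]; have [_ _ +] := Fadm X FX; exact.
Qed.

Let extend (G : set (V * U)) (v0 : V) (u0 : U) : set (V * U) :=
  fun p => exists a q, (G q \/ q = 0) /\ p = (q.1 + a *: v0, q.2 + a *: u0).

(** A maximal partial selection is total, because at a missing vector [v0] a suitable value [u0] can
    always be adjoined. *)
Lemma linear_selection :
  exists g : {linear V -> U}, forall v u, R v u -> R v (g v).
Proof.
have [G [[Glin Gfun GR] Gmax]] := Zorn_bigcup admissible_bigcup.
have maxE (B : set (V * U)) : admissible B -> (G `<=` B)%classic ->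
    forall p, B p -> G p.
  move=> Badm GB p Bp; apply: contrapT => nGp; apply: (Gmax B) => //.
  by split => // BG; exact/nGp/BG.
(* The empty graph is admissible too, so this is a consequence of maximality and not of closure. *)
have G0 : G 0.
  apply: (maxE (fun p => G p \/ p = 0)) => //; [|by left|by right].
  split.
  - move=> a p q [Gp|->] [Gq|->].
    + by left; exact: Glin.
    + left; have Gpp := Glin (-1) p p Gp Gp.
      have := Glin a p _ Gp Gpp.
      by rewrite scaleN1r addNr addr0.
    + by left; rewrite scaler0 add0r.
    + by right; rewrite scaler0 add0r.
  - by move=> u [/Gfun|[]].
  - move=> v u w [Gvu|[-> ->]] Rvw; first exact: GR Gvu Rvw.
    have := R_linear (-1) Rvw Rvw.
    by rewrite !scaleN1r !addNr.
have GZ a p : G p -> G (a *: p).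
  by move=> Gp; have := Glin a p 0 Gp G0; rewrite addr0.
have GB p q : G p -> G q -> G (p - q).
  by move=> Gp Gq; rewrite addrC -scaleN1r; exact: Glin.
have Gtot v0 : exists u, G (v0, u).
  apply: contrapT => ntot.
  (* If [R] has a value w at some [v1 + v0] with v1 in the domain of G, then [w - u1] serves.
     Otherwise 0 does: a vector [v + a *: v0] with a nonzero at which [R] has a value would scale to
     one of the excluded form. *)
  have [u0 Hu0] : exists u0, forall v u a w,
      G (v, u) -> R (v + a *: v0) w -> R (v + a *: v0) (u + a *: u0).
    have [[v1 [u1 [w [Gv1 Rw]]]]|nex] :=
      pselect (exists v1 u1 w, G (v1, u1) /\ R (v1 + v0) w).
      exists (w - u1) => v u a w' Gvu Rw'.
      have e1 : v + a *: v0 = a *: (v1 + v0) + (v - a *: v1).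
        by rewrite scalerDr [v - _]addrC addrACA addrN add0r addrC.
      have e2 : u + a *: (w - u1) = a *: w + (u - a *: u1).
        by rewrite scalerBr addrCA.
      have Gd : G (v - a *: v1, u - a *: u1).
        by have := GB _ _ Gvu (GZ a _ Gv1).
      rewrite e2 {1}e1; apply: R_linear => //.
      apply: (GR _ _ (w' - a *: w) Gd).
      have -> : v - a *: v1 = (- a) *: (v1 + v0) + (v + a *: v0).
        by rewrite scalerDr !scaleNr addrACA addNr addr0 addrC.
      by rewrite [w' - _]addrC -scaleNr; exact: R_linear.
    exists 0 => v u a w Gvu Rw; rewrite scaler0 addr0.
    have [a0|an0] := eqVneq a 0.
      by move: Rw; rewrite a0 scale0r addr0; exact: GR Gvu.
    case: nex; exists (a^-1 *: v), (a^-1 *: u), (a^-1 *: w); split.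
      exact: GZ a^-1 _ Gvu.
    have R0 : R 0 0.
      by have := R_linear (-1) Rw Rw; rewrite !scaleN1r !addNr.
    have := R_linear a^-1 Rw R0.
    by rewrite !addr0 scalerDr scalerA mulVf // scale1r.
  apply: (ntot); exists u0; apply: (maxE (extend G v0 u0)); first split.
  - move=> a p q [b [p' [Gp' ->]]] [c [q' [Gq' ->]]].
    exists (a * b + c), (a *: p' + q'); split.
      by left; apply: Glin; [case: Gp' => [|->] | case: Gq' => [|->]].
    by congr (_, _) => /=; rewrite !scalerDr scalerDl -scalerA addrACA.
  - move=> u [a [[v' u'] [Gq [/= e0 ->]]]].
    have {}Gq : G (v', u') by case: Gq => [|->].
    have [a0|an0] := eqVneq a 0.
      move: e0; rewrite a0 !scale0r !addr0 => v'0.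
      by apply: Gfun; rewrite v'0.
    case: (ntot); exists (- a^-1 *: u').
    have -> : v0 = - a^-1 *: v'.
      have -> : v' = - (a *: v0) by apply/eqP; rewrite -addr_eq0 -e0.
      by rewrite scalerN scaleNr opprK scalerA mulVf // scale1r.
    exact: GZ (- a^-1) _ Gq.
  - move=> v u w [a [[v' u'] [Gq [/= -> ->]]]] Rw.
    by apply: Hu0 Rw; case: Gq => [|->].
  - by move=> [v u] Gp; exists 0, (v, u); split;
    [left | rewrite !scale0r !addr0].
  - exists 1, 0; split; first by right.
    by rewrite !scale1r !add0r.
have /choice[g Gg] := Gtot.
have glin : linear g.
  move=> a x y; apply/eqP; rewrite -subr_eq0; apply/eqP; apply: Gfun.
  have := GB _ _ (Gg (a *: x + y)) (Glin a _ _ (Gg x) (Gg y)).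
  by rewrite /GRing.add /= /GRing.scale /=; congr G; congr (_, _);
    rewrite subrr.
pose glM := GRing.isLinear.Build k V U *:%R g glin.
pose gl : {linear V -> U} := HB.pack g glM.
by exists gl => v u; exact: GR (Gg v).
Qed.

End LinearSelection.

(** One tool for three splittings: of the inclusion of cocycles, of the class map and of the
    differential. *)
Lemma linear_quasi_inverse (k : fieldType) (U V : lmodType k)
    (f : {linear U -> V}) :
  exists g : {linear V -> U}, forall u, f (g (f u)) = f u.
Proof.
have [|g gP] := @linear_selection k V U (fun v u => f u = v).
  by move=> a v u v' u' <- <-; rewrite linearP.
by exists g => u; exact: (gP (f u) u erefl).
Qed.

(** * Deconcatenation and block decompositions of words *)

Section Cut.
Variable T : Type.

Fixpoint splits (s : seq T) : seq (seq T * seq T) :=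
  ([::], s) ::
  if s is x :: s' then [seq (x :: p.1, p.2) | p <- splits s'] else [::].

(** The deconcatenation coproduct followed by P; empty prefixes and suffixes are included. *)
Definition cut (X : nmodType) (P : seq T -> seq T -> X) (s : seq T) : X :=
  \sum_(p <- splits s) P p.1 p.2.

Lemma cut_nil (X : nmodType) (P : seq T -> seq T -> X) :
  cut P [::] = P [::] [::].
Proof. by rewrite /cut big_seq1. Qed.

Lemma cut_cons (X : nmodType) (P : seq T -> seq T -> X) x s :
  cut P (x :: s) = P [::] (x :: s) + cut (fun u => P (x :: u)) s.
Proof. by rewrite /cut /= big_cons big_map. Qed.

Lemma eq_cut (X : nmodType) (P Q : seq T -> seq T -> X) s :
  (forall u v, s = u ++ v -> P u v = Q u v) -> cut P s = cut Q s.
Proof.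
elim: s P Q => [|x s IHs] P Q PQ; first by rewrite !cut_nil PQ.
by rewrite !cut_cons PQ //; congr (_ + _); apply: IHs => u v suv; apply: PQ;
  rewrite suv.
Qed.

Lemma cut0 (X : nmodType) (P : seq T -> seq T -> X) s :
  (forall u v, s = u ++ v -> P u v = 0) -> cut P s = 0.
Proof. by move=> P0; rewrite (eq_cut P0) /cut big1. Qed.

Lemma cutD (X : nmodType) (P Q : seq T -> seq T -> X) s :
  cut (fun u v => P u v + Q u v) s = cut P s + cut Q s.
Proof. exact: big_split. Qed.

(** Coassociativity of deconcatenation. *)
Lemma cutA (X : nmodType) (P : seq T -> seq T -> seq T -> X) s :
  cut (fun w v => cut (fun t u => P t u v) w) s =
  cut (fun t w => cut (fun u v => P t u v) w) s.
Proof.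
elim: s P => [|x s IHs] P; first by rewrite !cut_nil.
rewrite !cut_cons cut_nil -addrA -IHs -cutD; congr (_ + _).
by apply: eq_cut => u v _; rewrite cut_cons.
Qed.

Lemma cut_last (X : nmodType) (P : seq T -> seq T -> X) s :
  (forall u v, s = u ++ v -> (0 < size v)%N -> P u v = 0) ->
  cut P s = P s [::].
Proof.
elim: s P => [|x s IHs] P P0; first by rewrite cut_nil.
rewrite cut_cons P0 // add0r IHs // => u v suv v0.
by rewrite (P0 (x :: u) v) // suv.
Qed.

End Cut.

Lemma linear_cut (k : pzRingType) (T : Type) (X Y : lmodType k) (g : X -> Y)
    (P : seq T -> seq T -> X) s :
  linear g -> g (cut P s) = cut (fun u v => g (P u v)) s.
Proof.
move=> glin; pose glM := GRing.isLinear.Build k X Y *:%R g glin.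
pose gl : {linear X -> Y} := HB.pack g glM.
exact: (raddf_sum gl).
Qed.

Lemma linear_fun0 (k : pzRingType) (X Y : lmodType k) (g : X -> Y) :
  linear g -> g 0 = 0.
Proof.
by move=> glin; have := glin (-1) 0 0; rewrite !scaleN1r !oppr0 !addr0 addNr.
Qed.

Lemma linear_funZ (k : pzRingType) (X Y : lmodType k) (g : X -> Y) a x :
  linear g -> g (a *: x) = a *: g x.
Proof.
by move=> glin; have := glin a x 0; rewrite (linear_fun0 glin) !addr0.
Qed.

Lemma cutZ (k : pzRingType) (T : Type) (X : lmodType k)
    (P : seq T -> seq T -> X) a s :
  a *: cut P s = cut (fun u v => a *: P u v) s.
Proof. by rewrite /cut scaler_sumr. Qed.

Section Blocks.
Variables (T : Type) (X : nmodType).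
Implicit Types (G : seq (seq T) -> X) (s : seq T).

(** [acc] is the block still open: each further letter either extends it or closes it and opens the
    next one, which keeps blocks nonempty. *)
Fixpoint blocks_from G (acc s : seq T) : X :=
  if s is x :: s' then
    blocks_from G (rcons acc x) s' +
    blocks_from (fun c => G (acc :: c)) [:: x] s'
  else G [:: acc].

Definition blocks_sum G s : X :=
  if s is x :: s' then blocks_from G [:: x] s' else G [::].

Lemma blocks_fromE G acc s :
  blocks_from G acc s =
  cut (fun p q => blocks_sum (fun c => G ((acc ++ p) :: c)) q) s.
Proof.
elim: s G acc => [|x s IHs] G acc /=; first by rewrite cut_nil /= cats0.
rewrite cut_cons cats0 /= addrC; congr (_ + _).
by rewrite IHs; apply: eq_cut => u v _; rewrite cat_rcons.
Qed.

Lemma blocks_sum_cons G x s :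
  blocks_sum G (x :: s) =
  cut (fun p q => blocks_sum (fun c => G ((x :: p) :: c)) q) s.
Proof. exact: blocks_fromE. Qed.

Lemma blocks_sumE G s : (0 < size s)%N ->
  blocks_sum G s =
  cut (fun p q => if p is [::] then 0 else
                  blocks_sum (fun c => G (p :: c)) q) s.
Proof.
case: s => // x s _.
by rewrite blocks_sum_cons cut_cons add0r.
Qed.

Lemma eq_blocks_sum G G' s :
  (forall c, flatten c = s -> G c = G' c) -> blocks_sum G s = blocks_sum G' s.
Proof.
have [n] := ubnP (size s); elim: n s G G' => // n IHn [|x s] G G' /= ltn GG.
  exact: GG.
rewrite !blocks_fromE; apply: eq_cut => u v suv.
apply: IHn => [|c cv]; last by apply: GG; rewrite /= cv suv.
by rewrite (leq_trans _ (ltn : (size s < n)%N)) // ltnS suv size_cat leq_addl.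
Qed.

End Blocks.

Lemma linear_blocks_sum (k : pzRingType) (T : Type) (X Y : lmodType k)
    (g : X -> Y) (G : seq (seq T) -> X) s :
  linear g -> g (blocks_sum G s) = blocks_sum (fun c => g (G c)) s.
Proof.
move=> glin; case: s => [|x s] //=; elim: s [:: x] G => //= y s IHs acc G.
by have := glin 1 (blocks_from G (rcons acc y) s)
  (blocks_from (fun c => G (acc :: c)) [:: y] s); rewrite !scale1r !IHs.
Qed.

Lemma blocks_sumD (T : Type) (X : nmodType) (G H : seq (seq T) -> X) s :
  blocks_sum (fun c => G c + H c) s = blocks_sum G s + blocks_sum H s.
Proof.
case: s => [|x s] //=; elim: s [:: x] G H => //= y s IHs acc G H.
by rewrite !IHs addrACA.
Qed.

Lemma blocks_sum0 (T : Type) (X : zmodType) (s : seq T) :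
  blocks_sum (fun=> 0 : X) s = 0.
Proof.
by apply/(addrI (blocks_sum (fun=> 0) s)); rewrite -blocks_sumD !addr0.
Qed.

(** * Products over all degrees, Koszul signs, shifted degrees *)

Section Total.
Variables (k : fieldType) (W : graded k).

Definition tot : Type := forall e, W e.

HB.instance Definition _ := gen_eqMixin tot.
HB.instance Definition _ := gen_choiceMixin tot.

Let tot_add (x y : tot) : tot := fun e => x e + y e.
Let tot_opp (x : tot) : tot := fun e => - x e.
Let tot_zero : tot := fun=> 0.
Let tot_scale (a : k) (x : tot) : tot := fun e => a *: x e.

Let tot_addA : associative tot_add.
Proof. by move=> x y z; apply: functional_extensionality_dep => e;
  exact: addrA. Qed.
Let tot_addC : commutative tot_add.
Proof. by move=> x y; apply: functional_extensionality_dep => e;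
  exact: addrC. Qed.
Let tot_add0 : left_id tot_zero tot_add.
Proof. by move=> x; apply: functional_extensionality_dep => e;
  exact: add0r. Qed.
Let tot_addN : left_inverse tot_zero tot_opp tot_add.
Proof. by move=> x; apply: functional_extensionality_dep => e;
  exact: addNr. Qed.

HB.instance Definition _ :=
  GRing.isZmodule.Build tot tot_addA tot_addC tot_add0 tot_addN.

Let tot_scaleA a b (x : tot) : tot_scale a (tot_scale b x) =
  tot_scale (a * b) x.
Proof. by apply: functional_extensionality_dep => e; exact: scalerA. Qed.
Let tot_scale1 : left_id 1 tot_scale.
Proof. by move=> x; apply: functional_extensionality_dep => e;
  exact: scale1r. Qed.
Let tot_scaleDr : right_distributive tot_scale +%R.
Proof. by move=> a x y; apply: functional_extensionality_dep => e;
  exact: scalerDr. Qed.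
Let tot_scaleDl (x : tot) : {morph tot_scale^~ x : a b / a + b}.
Proof. by move=> a b; apply: functional_extensionality_dep => e;
  exact: scalerDl. Qed.

HB.instance Definition _ := GRing.Zmodule_isLmodule.Build k tot
  tot_scaleA tot_scale1 tot_scaleDr tot_scaleDl.

Lemma totP (x y : tot) : (forall e, x e = y e) -> x = y.
Proof. exact: functional_extensionality_dep. Qed.

Lemma tot_eval_linear e : linear (fun x : tot => x e).
Proof. by []. Qed.

End Total.

Section Signs.
Variable k : fieldType.
Implicit Types a b : int.

Lemma signzD a b : (-1 : k) ^ (a + b) = (-1) ^ a * (-1) ^ b.
Proof. by rewrite expfzDr // oppr_eq0 oner_eq0. Qed.

Lemma signzN a : (-1 : k) ^ (- a) = (-1) ^ a.
Proof. by rewrite -exprz_inv invrN1. Qed.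

Lemma signzK a : (-1 : k) ^ a * (-1) ^ a = 1.
Proof. by rewrite -{1}signzN -signzD addNr. Qed.

Lemma signzS a : (-1 : k) ^ (a + 1) = - (-1) ^ a.
Proof. by rewrite signzD expr1z mulrN1. Qed.

(** Supplying the half-sum c turns a comparison of signs into an identity that [ring] or [lia] can
    check. *)
Lemma signz_eq a b c : a + b = c + c -> (-1 : k) ^ a = (-1) ^ b.
Proof.
move=> abc; have [d ->] : exists d, a = d + d + b by exists (c - b); lia.
by rewrite !signzD signzK mul1r.
Qed.

End Signs.

Section Degrees.
Variables (k : fieldType) (V : graded k).
Implicit Types s t u v : seq (homog V).

Lemma degs_nil : degs ([::] : seq (homog V)) = 0.
Proof. by rewrite /degs big_nil. Qed.

Lemma degs_cons (x : homog V) s : degs (x :: s) = tag x + degs s.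
Proof. by rewrite /degs big_cons. Qed.

Lemma degs_cat s t : degs (s ++ t) = degs s + degs t.
Proof. by rewrite /degs big_cat. Qed.

(** The degree of an operation of shifted degree c: the bar differential has
    c = 2, twisting cochains c = 1 and homotopies c = 0. *)
Definition dg (c : int) s : int := degs s + (c - (size s)%:Z).

(** The Koszul sign of moving an odd operator past s, a letter x counting with its shifted degree
    |x| - 1. *)
Definition eps s : k := (-1) ^ dg 0 s.

Lemma eps_nil : eps [::] = 1.
Proof. by rewrite /eps /dg degs_nil. Qed.

Lemma eps_cat s t : eps (s ++ t) = eps s * eps t.
Proof.
by rewrite /eps -signzD /dg degs_cat size_cat; congr (_ ^ _); lia.
Qed.

Lemma eps_cons x s : eps (x :: s) = eps [:: x] * eps s.
Proof. exact: (eps_cat [:: x]). Qed.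

Lemma epsK s : eps s * eps s = 1.
Proof. exact: signzK. Qed.

Lemma dgD c c' s t : dg c s + dg c' t = dg (c + c') (s ++ t).
Proof. by rewrite /dg degs_cat size_cat; lia. Qed.

(** Keeps a single component of the value, which is all of it when f satisfies [supp c]. *)
Definition letter (W : graded k) (c : int) (f : seq (homog V) -> tot W) s :
  homog W := hmk (f s (dg c s)).

Lemma letterE (W : graded k) c (f : seq (homog V) -> tot W) s e :
  e = dg c s -> letter c f s = hmk (f s e).
Proof. by move->. Qed.

Definition mlin (X : lmodType k) (f : seq (homog V) -> X) :=
  forall s1 s2 i (a : k) (x y : V i),
    f (s1 ++ hmk (a *: x + y) :: s2) =
      a *: f (s1 ++ hmk x :: s2) + f (s1 ++ hmk y :: s2).

Definition supp (W : graded k) c (f : seq (homog V) -> tot W) :=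
  forall s e, e != dg c s -> f s e = 0.

End Degrees.

(** * Coderivations of the tensor coalgebra *)

Section Insertion.
Variables (k : fieldType) (V : graded k).
Implicit Types s t u v : seq (homog V).

(** Isolating the insertions at the first position gives the recursion [ins_cons], through which
    [ins] is studied letter by letter. *)
Definition head_ins (b : seq (homog V) -> homog V) (X : lmodType k)
    (f : seq (homog V) -> X) s : X :=
  cut (fun u v => if (1 < size u)%N then f (b u :: v) else 0) s.

(** The coderivation of the tensor coalgebra with corestriction b, precomposed
    to f; blocks of length at most 1 are left out. *)
Definition ins (b : seq (homog V) -> homog V) (X : lmodType k)
    (f : seq (homog V) -> X) s : X :=
  cut (fun u w => eps u *: head_ins b (fun v => f (u ++ v)) w) s.

Lemma eq_head_ins b (X : lmodType k) (f g : seq (homog V) -> X) s :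
  (forall v, (size v < size s)%N -> (0 < size v)%N -> f v = g v) ->
  head_ins b f s = head_ins b g s.
Proof.
move=> fg; apply: eq_cut => u v suv; case: ifP => // u1.
by apply: fg; rewrite // suv size_cat /=; lia.
Qed.

Lemma eq_ins b (X : lmodType k) (f g : seq (homog V) -> X) s :
  (forall v, (size v < size s)%N -> (0 < size v)%N -> f v = g v) ->
  ins b f s = ins b g s.
Proof.
move=> fg; apply: eq_cut => u v suv; congr (_ *: _).
apply: eq_head_ins => w wv w0; apply: fg; rewrite ?suv !size_cat; lia.
Qed.

Variables (b : seq (homog V) -> homog V) (X : lmodType k).
Implicit Types f g : seq (homog V) -> X.

Lemma ins_nil f : ins b f [::] = 0.
Proof. by rewrite /ins cut_nil /head_ins cut_nil scaler0. Qed.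

Lemma ins1 f x : ins b f [:: x] = 0.
Proof.
by rewrite /ins cut_cons cut_nil /head_ins cut_cons !cut_nil !addr0 !scaler0
  addr0.
Qed.

Lemma ins_cons f x s :
  ins b f (x :: s) =
  head_ins b f (x :: s) + eps [:: x] *: ins b (fun v => f (x :: v)) s.
Proof.
rewrite /ins cut_cons eps_nil scale1r cutZ; congr (_ + _).
by apply: eq_cut => u v _; rewrite eps_cons scalerA.
Qed.

Lemma head_insD f g s :
  head_ins b (fun v => f v + g v) s = head_ins b f s + head_ins b g s.
Proof. by rewrite -cutD; apply: eq_cut => u v _; case: ifP; rewrite ?addr0. Qed.

Lemma insD f g s :
  ins b (fun v => f v + g v) s = ins b f s + ins b g s.
Proof.
by rewrite -cutD; apply: eq_cut => u v _; rewrite head_insD scalerDr.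
Qed.

Lemma linear_ins (Y : lmodType k) (g : X -> Y) f s :
  linear g -> g (ins b f s) = ins b (fun v => g (f v)) s.
Proof.
move=> glin; rewrite linear_cut //; apply: eq_cut => u v _.
rewrite linear_funZ // linear_cut //; congr (_ *: _).
by apply: eq_cut => w t _; case: ifP => // _; exact: linear_fun0.
Qed.

Lemma ins0 s : ins b (fun=> 0 : X) s = 0.
Proof.
by apply: cut0 => u v _; rewrite /head_ins cut0 ?scaler0 // => w t _; case: ifP.
Qed.

Lemma insZ a f s : ins b (fun v => a *: f v) s = a *: ins b f s.
Proof. by rewrite (@linear_ins X ( *:%R a)) // => c x y; exact: linearP. Qed.

Lemma head_ins_nil f : head_ins b f [::] = 0.
Proof. by rewrite /head_ins cut_nil. Qed.

Lemma head_ins_cut (P : seq (homog V) -> seq (homog V) -> X) s :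
  head_ins b (cut P) s =
  head_ins b (P [::]) s + cut (fun u v => head_ins b (P^~ v) u) s.
Proof.
rewrite /head_ins cutA -cutD; apply: eq_cut => u v _.
case: ifP => _; first by rewrite cut_cons.
by rewrite cut0 ?addr0.
Qed.

(** The co-Leibniz rule: after the contraction the block is one letter, which lies on one side of
    every cut; reaching the right side costs the sign of the left one. *)
Lemma ins_cut (P : seq (homog V) -> seq (homog V) -> X) s :
  ins b (cut P) s =
  cut (fun u v => ins b (P^~ v) u + eps u *: ins b (P u) v) s.
Proof.
elim: s P => [|x s IHs] P; first by rewrite cut_nil !ins_nil scaler0 addr0.
rewrite ins_cons (@eq_ins b X _
    (fun w => P [::] (x :: w) + cut (fun u => P (x :: u)) w));
  last by move=> w _ _; rewrite cut_cons.
rewrite insD IHs cut_cons ins_nil add0r eps_nil scale1r ins_cons.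
rewrite head_ins_cut cut_cons head_ins_nil add0r scalerDr addrACA.
congr (_ + _); rewrite cutZ -cutD; apply: eq_cut => u v _.
by rewrite ins_cons -addrA (eps_cons x u) -scalerA -scalerDr.
Qed.

End Insertion.

Section Multilinear.
Variables (k : fieldType) (V : graded k).
Implicit Types s t u v : seq (homog V).

Lemma mlin0 (X : lmodType k) (f : seq (homog V) -> X) u v i :
  mlin f -> f (u ++ hmk (0 : V i) :: v) = 0.
Proof.
move=> flin; apply: (linear_fun0 (g := fun x : V i => f (u ++ hmk x :: v))).
by move=> a x y; exact: flin.
Qed.

Lemma mlin_catl (X : lmodType k) (f : seq (homog V) -> X) t :
  mlin f -> mlin (fun s => f (t ++ s)).
Proof. by move=> flin s1 s2 i a x y; rewrite !catA; exact: flin. Qed.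

Lemma mlin_catr (X : lmodType k) (f : seq (homog V) -> X) t :
  mlin f -> mlin (fun s => f (s ++ t)).
Proof. by move=> flin s1 s2 i a x y; rewrite -!catA; exact: flin. Qed.

Lemma mlin_cons (X : lmodType k) (f : seq (homog V) -> X) x :
  mlin f -> mlin (fun s => f (x :: s)).
Proof. exact: (@mlin_catl _ _ [:: x]). Qed.

Lemma mlinZ (X : lmodType k) (f : seq (homog V) -> X) a :
  mlin f -> mlin (fun s => a *: f s).
Proof.
move=> flin s1 s2 i c x y.
by rewrite flin scalerDr !scalerA mulrC.
Qed.

Lemma mlinD (X : lmodType k) (f g : seq (homog V) -> X) :
  mlin f -> mlin g -> mlin (fun s => f s + g s).
Proof.
move=> flin glin s1 s2 i c x y.
by rewrite flin glin scalerDr addrACA.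
Qed.

Lemma mlin_linear (X Y : lmodType k) (g : X -> Y) (f : seq (homog V) -> X) :
  linear g -> mlin f -> mlin (fun s => g (f s)).
Proof. by move=> glin flin s1 s2 i a x y; rewrite flin glin. Qed.

Lemma mlin_cut (X : lmodType k) (P : seq (homog V) -> seq (homog V) -> X) :
  (forall v, mlin (P^~ v)) -> (forall u, mlin (P u)) -> mlin (cut P).
Proof.
move=> Pl Pr s1 s2 i a x y; elim: s1 P Pl Pr => [|z s1 IHs] P Pl Pr.
  rewrite !cat0s !cut_cons (Pr [::] [::]) scalerDr addrACA; congr (_ + _).
  rewrite cutZ -cutD; apply: eq_cut => u v _.
  exact: (Pl v [::]).
rewrite !cat_cons !cut_cons IHs; first 1 last.
- by move=> v; exact: (mlin_cons z (Pl v)).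
- by move=> u; exact: Pr.
by rewrite -!cat_cons Pr scalerDr addrACA.
Qed.

Lemma dg_mid c i (x y : V i) s1 s2 :
  dg c (s1 ++ hmk x :: s2) = dg c (s1 ++ hmk y :: s2).
Proof. by rewrite /dg !size_cat !degs_cat !degs_cons. Qed.

Lemma eps_mid i (x y : V i) s1 s2 :
  eps (s1 ++ hmk x :: s2) = eps (s1 ++ hmk y :: s2).
Proof. by rewrite /eps (dg_mid _ x y). Qed.

Lemma mlin_eps (X : lmodType k) (f : seq (homog V) -> X) :
  mlin f -> mlin (fun s => eps s *: f s).
Proof.
move=> flin s1 s2 i a x y; rewrite flin scalerDr !scalerA mulrC.
by rewrite (eps_mid _ x) (eps_mid _ y).
Qed.

(** The degree of the letter depends on s only through the degrees of its entries, so it is the same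
    for all three words in the linearity equation. *)
Lemma mlin_letter (W : graded k) (X : lmodType k) c
    (f : seq (homog V) -> tot W) (g : seq (homog W) -> X)
    (t u : seq (homog W)) :
  mlin f -> mlin g -> mlin (fun s => g (t ++ letter c f s :: u)).
Proof.
move=> flin glin s1 s2 i a x y.
rewrite (letterE _ (dg_mid c x (a *: x + y) s1 s2)).
rewrite (letterE _ (dg_mid c x y s1 s2)) /letter.
by rewrite flin; exact: glin.
Qed.

Lemma mlin_head_ins (X : lmodType k) (b : seq (homog V) -> tot V) c
    (f : seq (homog V) -> X) :
  mlin b -> mlin f -> mlin (head_ins (letter c b) f).
Proof.
move=> blin flin; apply: mlin_cut => [v|u].
  move=> s1 s2 i a x y; rewrite !size_cat /=; case: ifP => _.
    exact: (mlin_letter c [::] v blin flin).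
  by rewrite scaler0 addr0.
move=> s1 s2 i a x y; case: ifP => _; last by rewrite scaler0 addr0.
exact: mlin_cons.
Qed.

Lemma mlin_cut_param (T : Type) (X : lmodType k)
    (P : seq (homog V) -> seq T -> seq T -> X) w :
  (forall p q, mlin (fun u => P u p q)) -> mlin (fun u => cut (P u) w).
Proof.
move=> Plin s1 s2 i a x y; rewrite cutZ -cutD.
by apply: eq_cut => p q _; exact: Plin.
Qed.

Lemma mlin_ins (X : lmodType k) (b : seq (homog V) -> tot V) c
    (f : seq (homog V) -> X) :
  mlin b -> mlin f -> mlin (ins (letter c b) f).
Proof.
move=> blin flin; apply: mlin_cut => [v|u].
  apply: mlin_eps; apply: mlin_cut_param => p q.
  move=> s1 s2 i a x y; case: ifP => _; last by rewrite scaler0 addr0.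
  exact: mlin_catr.
by apply/mlinZ/mlin_head_ins => //; exact: mlin_catl.
Qed.

End Multilinear.

Section InsLetter.
Variables (k : fieldType) (V : graded k) (b : seq (homog V) -> tot V).
Implicit Types (s t u v : seq (homog V)).

(** Wherever a block is contracted by [letter 2 b], the shorter word has as [dg c] the number
    [dg (c + 1) s]; hence F has one and the same index in all summands and comes out of the sum. *)
Lemma ins_graded (X Y : lmodType k) c (F : int -> X -> Y)
    (f : seq (homog V) -> X) s :
  (forall e, linear (F e)) ->
  ins (letter 2 b) (fun v => F (dg c v) (f v)) s =
  F (dg (c + 1) s) (ins (letter 2 b) f s).
Proof.
move=> Flin; rewrite linear_ins // /ins.
apply: eq_cut => u w suw; congr (_ *: _).
apply: eq_cut => p q wpq; case: ifP => // _; congr (F _ _).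
by rewrite suw wpq /dg !(degs_cat, degs_cons, size_cat) /= /dg; lia.
Qed.

Lemma ins_eps (X : lmodType k) (f : seq (homog V) -> X) s :
  ins (letter 2 b) (fun v => eps v *: f v) s =
  - (eps s *: ins (letter 2 b) f s).
Proof.
rewrite (ins_graded 0 (F := fun e x => (-1) ^ e *: x)); last first.
  by move=> e a x y; exact: linearP.
rewrite -scaleNr -signzS; congr (_ *: _); congr (_ ^ _).
by rewrite /dg; lia.
Qed.

Lemma ins_letter (W : graded k) (X : lmodType k) c
    (f : seq (homog V) -> tot W) (g : seq (homog W) -> X)
    (t t' : seq (homog W)) s :
  mlin g ->
  ins (letter 2 b) (fun v => g (t ++ letter c f v :: t')) s =
  g (t ++ letter (c + 1) (ins (letter 2 b) f) s :: t').
Proof.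
move=> glin.
apply: (ins_graded c (F := fun e (x : tot W) => g (t ++ hmk (x e) :: t'))).
by move=> e a x y; exact: glin.
Qed.

End InsLetter.

Section InsIns.
Variables (k : fieldType) (V : graded k) (X : lmodType k).
Variables (b : seq (homog V) -> tot V).
Implicit Types (s t u v : seq (homog V)).

Lemma eps_letter u : eps [:: letter 2 b u] = - eps u.
Proof.
rewrite /eps -signzS; apply: (@signz_eq _ _ _ (dg 0 u + 1)).
by rewrite /dg degs_cons degs_nil /= /dg; lia.
Qed.

Hypothesis b_norm : forall s, (size s <= 1)%N -> b s = 0.

(** The square of an odd coderivation: contractions of disjoint blocks occur in both orders with
    opposite signs and cancel. The nested ones form an even coderivation, hence without [eps], of
    shifted degree 3. *)
Lemma ins_ins (f : seq (homog V) -> X) s : mlin f ->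
  ins (letter 2 b) (ins (letter 2 b) f) s =
  cut (fun u w => cut (fun v t =>
    f (u ++ letter 3 (ins (letter 2 b) b) v :: t)) w) s.
Proof.
have letter0 c (h : seq (homog V) -> tot V) (g : seq (homog V) -> X) u t v :
    mlin g -> h v = 0 -> g (u ++ letter c h v :: t) = 0.
  by move=> glin h0; rewrite /letter h0; exact: mlin0.
elim: s f => [|x s IHs] f flin.
  rewrite ins_nil !cut_nil letter0 //; exact: ins_nil.
pose D (g : seq (homog V) -> X) := ins (letter 2 b) g.
pose H (g : seq (homog V) -> X) := head_ins (letter 2 b) g.
(* The second contraction either swallows the letter just produced or lies to its right; the minus
   sign is that of [eps_letter]. *)
have HD : H (D f) (x :: s) = H (H f) (x :: s) -
    cut (fun u v => if (1 < size u)%N then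
      eps u *: D (fun w => f (letter 2 b u :: w)) v else 0) (x :: s).
  rewrite -scaleN1r cutZ -cutD; apply: eq_cut => u v _.
  case: ifP => _; last by rewrite scaler0 addr0.
  by rewrite /D ins_cons eps_letter scaleNr scaleN1r.
(* The disjoint contractions return here with the opposite sign, next to the nested ones at the
   head. The length guard is lost harmlessly because b vanishes on single letters. *)
have DH : D (H f) (x :: s) =
    cut (fun v t => f (letter 3 (ins (letter 2 b) b) v :: t)) (x :: s) +
    cut (fun u v => if (1 < size u)%N then
      eps u *: D (fun w => f (letter 2 b u :: w)) v else 0) (x :: s).
  rewrite /D /H /head_ins ins_cut -cutD; apply: eq_cut => u v _.
  congr (_ + _); last first.
    by case: ifP => // _; rewrite ins0 scaler0.
  rewrite -(ins_letter b 2 b [::] v u flin); apply: eq_ins => w _ _.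
  case: ltnP => // w1; symmetry.
  by apply: (letter0 2 b f [::] v w flin); exact: b_norm.
have := IHs _ (mlin_cons x flin); rewrite cut_cons => /= <-.
rewrite ins_cons -[head_ins _ _ _]/(H (D f) (x :: s)) HD.
rewrite (@eq_ins _ _ _ _ _ (fun v => H f (x :: v) +
    eps [:: x] *: D (fun w => f (x :: w)) v));
  last by move=> v _ _; rewrite /D ins_cons.
rewrite insD insZ scalerDr scalerA epsK scale1r !addrA; congr (_ + _).
apply/eqP; rewrite addrAC subr_eq -DH eq_sym; apply/eqP.
by rewrite /D ins_cons.
Qed.

Lemma ins_ins_top (f : seq (homog V) -> X) s : mlin f ->
  (forall v, (size v < size s)%N -> ins (letter 2 b) b v = 0) ->
  ins (letter 2 b) (ins (letter 2 b) f) s =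
  f [:: letter 3 (ins (letter 2 b) b) s].
Proof.
move=> flin Q0; rewrite ins_ins //.
have f0 u v t : s = u ++ v ++ t -> (0 < size u + size t)%N ->
    f (u ++ letter 3 (ins (letter 2 b) b) v :: t) = 0.
  move=> suvt ut; rewrite /letter Q0 ?mlin0 //.
  by rewrite suvt !size_cat; lia.
case: s f0 {Q0} => [|x s] f0; first by rewrite !cut_nil.
rewrite cut_cons cut_last; last first.
  by move=> v t svt t0; apply: (f0 [::]).
rewrite cut0 ?addr0 // => u w suw; apply: cut0 => v t wvt.
by apply: (f0 (x :: u)); rewrite //= suw wvt.
Qed.

End InsIns.

(** * Morphisms of tensor coalgebras *)

Lemma cut_map (S T : Type) (h : S -> T) (X : nmodType)
    (P : seq T -> seq T -> X) s :
  cut P (map h s) = cut (fun u v => P (map h u) (map h v)) s.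
Proof.
elim: s P => [|x s IHs] P; first by rewrite !cut_nil.
by rewrite /= !cut_cons IHs.
Qed.

(** The combinatorial core of the compatibility of coalgebra morphisms with deconcatenation. *)
Lemma blocks_sum_cut (T : Type) (X : nmodType)
    (P : seq (seq T) -> seq (seq T) -> X) s :
  blocks_sum (cut P) s =
  cut (fun u v => blocks_sum (fun p => blocks_sum (P p) v) u) s.
Proof.
have [n] := ubnP (size s); elim: n s P => // n IHn [|x s] P ltn.
  by rewrite cut_nil /= cut_nil.
rewrite cut_cons blocks_sum_cons /=.
transitivity (cut (fun p q => blocks_sum (fun c => P [::] ((x :: p) :: c)) q +
    blocks_sum (cut (fun c => P ((x :: p) :: c))) q) s).
  apply: eq_cut => u v _; rewrite -blocks_sumD.
  by apply: eq_blocks_sum => c _; rewrite cut_cons.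
rewrite cutD -/(blocks_sum (P [::]) (x :: s)) blocks_sum_cons; congr (_ + _).
transitivity (cut (fun p w => cut (fun u v => blocks_sum (fun c =>
    blocks_sum (P ((x :: p) :: c)) v) u) w) s).
  apply: eq_cut => u v suv; apply: IHn.
  by move: ltn; rewrite /= suv size_cat; lia.
by rewrite -cutA; apply: eq_cut => u v _; exact/esym/blocks_sum_cons.
Qed.

Section Pull.
Variables (k : fieldType) (V W : graded k).
Implicit Types s u v : seq (homog V).

(** The morphism of tensor coalgebras with corestriction h, precomposed to g. *)
Definition pullback h (X : nmodType) (g : seq (homog W) -> X) s : X :=
  blocks_sum (fun c => g (map h c)) s.

Section MultilinearBlocks.
Variable X : lmodType k.

Lemma mlin_blocks_from_param (U : graded k)
    (G : seq (homog U) -> seq (seq (homog V)) -> X) acc s :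
  (forall c, mlin (G^~ c)) ->
  mlin (fun u : seq (homog U) => blocks_from (G u) acc s).
Proof.
elim: s acc G => [|x s IHs] acc G Glin /=; first exact: Glin.
by apply: mlinD; apply: IHs.
Qed.

Lemma mlin_blocks_from_acc (G : seq (seq (homog V)) -> X) s :
  (forall c c', mlin (fun w => G (c ++ w :: c'))) ->
  mlin (fun acc => blocks_from G acc s).
Proof.
elim: s G => [|x s IHs] G Glin /=; first exact: (Glin [::] [::]).
apply: mlinD.
  have := mlin_catr [:: x] (IHs G Glin).
  by move=> h s1 s2 i a y z; rewrite -!cats1; exact: h.
by apply: mlin_blocks_from_param => c; exact: (Glin [::] c).
Qed.

Lemma mlin_blocks_from (G : seq (seq (homog V)) -> X) acc :
  (forall c c', mlin (fun w => G (c ++ w :: c'))) ->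
  mlin (blocks_from G acc).
Proof.
move=> Glin s1 s2 i a x y; elim: s1 acc G Glin => [|z s1 IHs] acc G Glin /=.
  rewrite -!cats1.
  rewrite (mlin_blocks_from_acc s2 Glin acc [::]).
  rewrite (mlin_blocks_from_acc s2 _ [::] [::]).
    by rewrite scalerDr addrACA.
  by move=> c c'; exact: (Glin (acc :: c) c').
rewrite !IHs // => [|c c']; last exact: (Glin (acc :: c) c').
by rewrite scalerDr addrACA.
Qed.

End MultilinearBlocks.

Variable f : seq (homog V) -> tot W.
Hypothesis f_lin : mlin f.

Lemma mlin_pullback (X : lmodType k) (g : seq (homog W) -> X) :
  mlin g -> mlin (pullback (letter 1 f) g).
Proof.
move=> glin.
have Glin c c' : mlin (fun w => g (map (letter 1 f) (c ++ w :: c'))).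
  have := mlin_letter 1 (map (letter 1 f) c) (map (letter 1 f) c') f_lin glin.
  by move=> h s1 s2 i a x y; rewrite !map_cat; exact: h.
case=> [|z s1] s2 i a x y; rewrite /pullback /=.
  exact: (mlin_blocks_from_acc s2 Glin [::] [::]).
exact: mlin_blocks_from.
Qed.

Lemma mlin_pullback_param (X : lmodType k)
    (G : seq (homog W) -> seq (homog W) -> X) s :
  (forall c, mlin (G^~ c)) ->
  mlin (fun w : seq (homog W) => pullback (letter 1 f) (G w) s).
Proof.
move=> Glin; case: s => [|z s]; first exact: Glin.
rewrite /pullback /=; refine (mlin_blocks_from_param
  (U := W) (G := fun w c => G w (map (letter 1 f) c)) [:: z] s _); move=> c.
exact: Glin.
Qed.

Lemma pullback_cut (X : nmodType) (P : seq (homog W) -> seq (homog W) -> X) s :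
  pullback (letter 1 f) (cut P) s =
  cut (fun u v =>
    pullback (letter 1 f) (fun p => pullback (letter 1 f) (P p) v) u) s.
Proof.
rewrite /pullback -blocks_sum_cut; apply: eq_blocks_sum => c _.
exact: cut_map.
Qed.

Lemma pullbackE (X : nmodType) (g : seq (homog W) -> X) s : (0 < size s)%N ->
  pullback (letter 1 f) g s =
  cut (fun u v => if u is [::] then 0 else
       pullback (letter 1 f) (fun c => g (letter 1 f u :: c)) v) s.
Proof. exact: blocks_sumE. Qed.

Lemma eps_letter1 u : eps [:: letter 1 f u] = eps u.
Proof.
by rewrite /eps; congr (_ ^ _); rewrite /dg degs_cons degs_nil /= /dg; lia.
Qed.

(** The letter of a block u has shifted degree [dg 1 u - 1 = dg 0 u]: the coalgebra morphism has
    degree 0 and commutes with every degree-dependent sign. *)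
Lemma dg_letters c (bs : seq (seq (homog V))) :
  dg c (map (letter 1 f) bs) = dg c (flatten bs).
Proof.
suff E : degs (map (letter 1 f) bs) =
    degs (flatten bs) + ((size bs)%:Z - (size (flatten bs))%:Z).
  by rewrite /dg size_map E; lia.
elim: bs => [|u bs IHs] /=; first by rewrite !degs_nil.
by rewrite degs_cons degs_cat IHs size_cat /= /dg; lia.
Qed.

Lemma pullback_graded (X Y : lmodType k) c (F : int -> X -> Y)
    (h : seq (homog W) -> X) s :
  (forall e, linear (F e)) ->
  pullback (letter 1 f) (fun w => F (dg c w) (h w)) s =
  F (dg c s) (pullback (letter 1 f) h s).
Proof.
move=> Flin; rewrite /pullback linear_blocks_sum //.
by apply: eq_blocks_sum => bs bss; rewrite dg_letters bss.
Qed.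

Lemma pullback_eps (X : lmodType k) (h : seq (homog W) -> X) s :
  pullback (letter 1 f) (fun w => eps w *: h w) s =
  eps s *: pullback (letter 1 f) h s.
Proof.
apply: (pullback_graded 0 (F := fun e x => (-1) ^ e *: x)) => e a x y.
exact: linearP.
Qed.

Lemma pullback_letter (Z : graded k) (X : lmodType k) c
    (h : seq (homog W) -> tot Z) (g : seq (homog Z) -> X)
    (t t' : seq (homog Z)) s :
  mlin g ->
  pullback (letter 1 f) (fun w => g (t ++ letter c h w :: t')) s =
  g (t ++ letter c (pullback (letter 1 f) h) s :: t').
Proof.
move=> glin.
apply: (pullback_graded c (F := fun e (x : tot Z) => g (t ++ hmk (x e) :: t'))).
by move=> e a x y; exact: glin.
Qed.

Variables (b : seq (homog V) -> tot V) (b' : seq (homog W) -> tot W).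
Hypothesis b'_norm : forall w, (size w <= 1)%N -> b' w = 0.

(** Its vanishing is the A-infinity morphism equation in bar form, for zero differentials on both
    sides. *)
Definition defect s : tot W :=
  ins (letter 2 b) f s - pullback (letter 1 f) b' s.

(** Induction on length, splitting off the first block: contractions inside it produce its defect
    and a term with b', those in later blocks fall under the induction hypothesis for g with one
    letter prepended. *)
Lemma ins_pullback (X : lmodType k) (g : seq (homog W) -> X) s :
  mlin g -> (0 < size s)%N ->
  (forall v, (0 < size v < size s)%N -> defect v = 0) ->
  ins (letter 2 b) (pullback (letter 1 f) g) s =
  pullback (letter 1 f) (ins (letter 2 b') g) s + g [:: letter 2 defect s].
Proof.
have [n] := ubnP (size s); elim: n s g => // n IHn s g ltn glin s0 def0.
pose C (Y : lmodType k) (h : seq (homog W) -> Y) := pullback (letter 1 f) h.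
pose P u v : X :=
  if u is [::] then 0 else C X (fun c => g (letter 1 f u :: c)) v.
have CE u : (0 < size u)%N -> C X g u = cut P u by exact: pullbackE.
rewrite -/(C X g) (@eq_ins _ _ _ _ _ (cut P)); last by move=> v _; exact: CE.
rewrite ins_cut.
have gC v : mlin (fun w : seq (homog W) => C X (fun c => g (w ++ c)) v).
  by apply: mlin_pullback_param => c; exact: mlin_catr.
have hC : C X (head_ins (letter 2 b') g) s =
  cut (fun u v => C X (fun c => g (letter 2 (C (tot W) b') u :: c)) v) s.
  rewrite /C pullback_cut; apply: eq_cut => u v _.
  apply: etrans; last exact: (pullback_letter 2 b' [::] [::] u (gC v)).
  apply: eq_blocks_sum => c _; case: ltnP => // c1 /=; symmetry.
  rewrite /letter b'_norm // [RHS]blocks_sum0.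
  exact: (mlin0 [::] [::] _ (gC v)).
have gl c (x y : tot W) u v :
  C X (fun w => g (letter c (fun=> x + y) u :: w)) v =
  C X (fun w => g (letter c (fun=> x) u :: w)) v +
  C X (fun w => g (letter c (fun=> y) u :: w)) v.
  rewrite -blocks_sumD; apply: eq_blocks_sum => w _.
  have := glin [::] (map (letter 1 f) w) _ 1 (x (dg c u)) (y (dg c u)).
  by rewrite !scale1r.
have lhs u v : s = u ++ v -> (0 < size u)%N ->
  ins (letter 2 b) (P^~ v) u + eps u *: ins (letter 2 b) (P u) v =
  C X (fun c => g (letter 2 defect u :: c)) v +
  (C X (fun c => g (letter 2 (C (tot W) b') u :: c)) v +
   eps u *: C X (fun c =>
     ins (letter 2 b') (fun t => g (letter 1 f u :: t)) c) v).
  move=> suv u0; rewrite addrA; congr (_ + _).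
    have := gl 2 (defect u) (C _ b' u) u v.
    rewrite {1}/defect subrK => <-.
    rewrite (@eq_ins _ _ _ _ _
      (fun w => C X (fun c => g ([:: letter 1 f w] ++ c)) v)).
      exact: (ins_letter b 1 f [::] [::] u (gC v)).
    by case.
  congr (_ *: _).
  have PuE w : P u w = C X (fun c => g (letter 1 f u :: c)) w.
    by case: (u) u0.
  rewrite (@eq_ins _ _ _ _ _ (C X (fun c => g (letter 1 f u :: c)))) //.
  case: v suv => [|y v] suv; first by rewrite ins_nil /C /= ins_nil.
  rewrite (IHn _ (fun c => g (letter 1 f u :: c))) //.
  - rewrite /letter def0 ?addr0 //; last by rewrite suv size_cat /=; lia.
    by rewrite (mlin0 [:: letter 1 f u] [::] _ glin) addr0.
  - by move: ltn; rewrite suv size_cat /=; lia.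
  - exact: mlin_cons.
  - by move=> w /andP[w0 wv]; apply: def0; rewrite w0 suv size_cat; lia.
have rhs : C X (ins (letter 2 b') g) s =
  cut (fun u v => C X (fun c => g (letter 2 (C (tot W) b') u :: c)) v) s +
  cut (fun u v => if u is [::] then 0 else eps u *:
    C X (fun c => ins (letter 2 b') (fun t => g (letter 1 f u :: t)) c) v) s.
  rewrite -hC /C !pullbackE // -cutD; apply: eq_cut => -[|y u] v _.
    by rewrite addr0.
  rewrite /pullback (linear_blocks_sum (g := *:%R (eps (y :: u)))); last first.
    by move=> a x z; exact: linearP.
  rewrite -blocks_sumD; apply: eq_blocks_sum => c _.
  by rewrite ins_cons eps_letter1.
(* A first block shorter than s has zero defect, so only the block s itself contributes. *)
have top : cut (fun u v => if u is [::] then 0 else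
    C X (fun c => g (letter 2 defect u :: c)) v) s = g [:: letter 2 defect s].
  case: s s0 def0 {ltn hC lhs rhs} => [|y s] // _ def0; rewrite cut_last //.
  move=> [|z u] v suv v0 //; rewrite /letter def0; last first.
    by rewrite suv size_cat /=; lia.
  rewrite /C /pullback -[RHS](blocks_sum0 X v).
  by apply: eq_blocks_sum => c _; exact: (mlin0 [::] _ _ glin).
rewrite -/(C X (ins (letter 2 b') g)) rhs -top -!cutD; apply: eq_cut => u v suv.
case: u suv => [|y u] suv; last by rewrite lhs // addrC.
rewrite ins_nil ins0 scaler0 !addr0; symmetry.
have b'0 : C (tot W) b' [::] = 0 by exact: b'_norm.
rewrite /letter b'0; exact: (mlin0 [::] [::] _ (gC v)).
Qed.

End Pull.

(** * The convolution algebra of maps from words to A *)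

Section TotalDifferential.
Variables (k : fieldType) (C : complex k).

(** Indexing by the target degree makes this an endomorphism of [tot C]; [component] transports from
    degree e - 1 + 1 to e. *)
Definition tdiff (x : tot C) : tot C :=
  fun e => component (hmk (diff C (e - 1) (x (e - 1)))) e.

Lemma tdiffE (x : tot C) e : tdiff x (e + 1) = diff C e (x e).
Proof.
by rewrite /tdiff; move: (e + 1 - 1) (addrK 1 e) => e' ->; rewrite component_id.
Qed.

Lemma tdiff_linear : linear tdiff.
Proof.
move=> a x y; apply: totP => e; rewrite /tdiff.
by have -> : (a *: x + y) (e - 1) = a *: x (e - 1) + y (e - 1) by [];
  rewrite linearP component_linear.
Qed.

Lemma tdiffD : {morph tdiff : x y / x + y}.
Proof. by move=> x y; rewrite -{1}[x]scale1r tdiff_linear scale1r. Qed.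

Lemma tdiffZ a x : tdiff (a *: x) = a *: tdiff x.
Proof. exact: linear_funZ tdiff_linear. Qed.

Lemma tdiffN x : tdiff (- x) = - tdiff x.
Proof. by rewrite -!scaleN1r tdiffZ. Qed.

Lemma tdiff0 : tdiff 0 = 0.
Proof. exact: linear_fun0 tdiff_linear. Qed.

End TotalDifferential.

Section TotalProduct.
Variables (k : fieldType) (A : dga k).
Implicit Types (x y z : tot A).

(** Restricting the product to one pair of degrees makes it bilinear on all of
    [tot A], although the elements of [tot A] may have infinitely many nonzero
    components. *)
Definition pmul (i j : int) x y : tot A :=
  fun e => component (hmk (dmul (x i) (y j))) e.

Lemma pmul_linearl i j y : linear (fun x => pmul i j x y).
Proof.
move=> a x x'; apply: totP => e; rewrite /pmul.
by have -> : (a *: x + x') i = a *: x i + x' i by [];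
  rewrite dmul_linearl component_linear.
Qed.

Lemma pmul_linearr i j x : linear (pmul i j x).
Proof.
move=> a y y'; apply: totP => e; rewrite /pmul.
by have -> : (a *: y + y') j = a *: y j + y' j by [];
  rewrite dmul_linearr component_linear.
Qed.

Lemma pmulA i j l x y z :
  pmul i (j + l) x (pmul j l y z) = pmul (i + j) l (pmul i j x y) z.
Proof. by apply: totP => e; rewrite /pmul !component_id dmulA. Qed.

Lemma pmul_supp i j x y e : e != i + j -> pmul i j x y e = 0.
Proof. by move=> ne; rewrite /pmul component_neq //= eq_sym. Qed.

Lemma tdiff_pmul i j x y :
  tdiff (pmul i j x y) =
  pmul (i + 1) j (tdiff x) y + (-1) ^ i *: pmul i (j + 1) x (tdiff y).
Proof.
apply: totP => e; rewrite -(subrK 1 e); set e' := e - 1.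
rewrite tdiffE -[RHS]/(pmul (i + 1) j (tdiff x) y (e' + 1) +
  (-1) ^ i *: pmul i (j + 1) x (tdiff y) (e' + 1)).
have [->|ne] := eqVneq e' (i + j).
  by rewrite {1}/pmul component_id dmul_leibniz /pmul !tdiffE.
rewrite !pmul_supp ?linear0 ?scaler0 ?addr0 //.
  by apply: contra ne => /eqP ?; apply/eqP; lia.
by apply: contra ne => /eqP ?; apply/eqP; lia.
Qed.

End TotalProduct.

Section Convolution.
Variables (k : fieldType) (V : graded k) (A : dga k).
Implicit Types (f g h : seq (homog V) -> tot A) (s u v w : seq (homog V)).
Implicit Types (p q r : int).

(** p and q are the shifted degrees of the factors and select the components to multiply. No Koszul
    sign is built in; where one is due, the left factor is written [eps u *: f u]. *)
Definition conv p q f g s : tot A :=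
  cut (fun u v => pmul (dg p u) (dg q v) (f u) (g v)) s.

(** As g is zero on the empty word, f is evaluated on proper prefixes only. This is how the
    component to be solved for drops out of the right-hand side. *)
Lemma eq_convl p q f f' g s :
  (forall u, (size u < size s)%N -> f u = f' u) -> g [::] = 0 ->
  conv p q f g s = conv p q f' g s.
Proof.
move=> ff g0; apply: eq_cut => u [|y v] suv.
  by rewrite g0 !(linear_fun0 (pmul_linearr _ _ _)).
by rewrite ff // suv size_cat /=; lia.
Qed.

Lemma eq_convr p q f g g' s :
  (forall u, (size u < size s)%N -> g u = g' u) -> f [::] = 0 ->
  conv p q f g s = conv p q f g' s.
Proof.
move=> gg f0; apply: eq_cut => -[|y u] v suv.
  by rewrite f0 !(linear_fun0 (pmul_linearl _ _ _)).
by rewrite gg // suv size_cat /=; lia.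
Qed.

Lemma eq_conv p q f f' g g' s : f =1 f' -> g =1 g' ->
  conv p q f g s = conv p q f' g' s.
Proof. by move=> ff gg; apply: eq_cut => u v _; rewrite ff gg. Qed.

Lemma convDl p q f f' g s :
  conv p q (fun u => f u + f' u) g s = conv p q f g s + conv p q f' g s.
Proof.
rewrite -cutD; apply: eq_cut => u v _.
by have := pmul_linearl (dg p u) (dg q v) (g v) 1 (f u) (f' u);
  rewrite !scale1r.
Qed.

Lemma convDr p q f g g' s :
  conv p q f (fun u => g u + g' u) s = conv p q f g s + conv p q f g' s.
Proof.
rewrite -cutD; apply: eq_cut => u v _.
by have := pmul_linearr (dg p u) (dg q v) (f u) 1 (g v) (g' v);
  rewrite !scale1r.
Qed.

Lemma convNl p q f g s : conv p q (fun u => - f u) g s = - conv p q f g s.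
Proof.
rewrite -scaleN1r cutZ; apply: eq_cut => u v _.
by rewrite -scaleN1r (linear_funZ _ _ (pmul_linearl _ _ _)).
Qed.

Lemma convNr p q f g s : conv p q f (fun u => - g u) s = - conv p q f g s.
Proof.
rewrite -scaleN1r cutZ; apply: eq_cut => u v _.
by rewrite -scaleN1r (linear_funZ _ _ (pmul_linearr _ _ _)).
Qed.

Lemma conv_nil p q f g : f [::] = 0 -> conv p q f g [::] = 0.
Proof.
by move=> f0; rewrite /conv cut_nil f0 (linear_fun0 (pmul_linearl _ _ _)).
Qed.

Lemma convA p q r f g h s :
  conv p (q + r) f (conv q r g h) s = conv (p + q) r (conv p q f g) h s.
Proof.
transitivity (cut (fun t w => cut (fun u v =>
    pmul (dg p t) (dg (q + r) w) (f t) (pmul (dg q u) (dg r v) (g u) (h v))) w)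
      s).
  apply: eq_cut => t w _; exact/linear_cut/pmul_linearr.
transitivity (cut (fun w v => cut (fun t u =>
    pmul (dg p t) (dg q u + dg r v) (f t) (pmul (dg q u) (dg r v) (g u) (h v)))
      w) s).
  rewrite cutA; apply: eq_cut => t w _; apply: eq_cut => u v ->.
  by rewrite dgD.
apply: eq_cut => w v _.
rewrite (linear_cut _ _ (pmul_linearl (dg (p + q) w) (dg r v) (h v))).
by apply: eq_cut => t u ->; rewrite -dgD pmulA.
Qed.

Lemma tdiff_conv p q f g s :
  tdiff (conv p q f g s) =
  conv (p + 1) q (fun u => tdiff (f u)) g s +
  (-1) ^ p *: conv p (q + 1) (fun u => eps u *: f u) (fun u => tdiff (g u)) s.
Proof.
have dgS c u : dg (c + 1) u = dg c u + 1 by rewrite /dg; lia.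
rewrite (linear_cut _ _ (@tdiff_linear _ A)) cutZ -cutD; apply: eq_cut => u v _.
rewrite tdiff_pmul !dgS (linear_funZ _ _ (pmul_linearl _ _ _)) scalerA.
congr (_ + _ *: _); rewrite /eps -signzD; congr (_ ^ _); rewrite /dg; lia.
Qed.

Lemma eps_conv p q f g s :
  eps s *: conv p q f g s =
  conv p q (fun u => eps u *: f u) (fun u => eps u *: g u) s.
Proof.
rewrite cutZ; apply: eq_cut => u v ->.
rewrite (linear_funZ _ _ (pmul_linearl _ _ _)).
by rewrite (linear_funZ _ _ (pmul_linearr _ _ _)) scalerA eps_cat.
Qed.

Lemma ins_conv (b : seq (homog V) -> tot V) p q f g s :
  ins (letter 2 b) (conv p q f g) s =
  conv (p + 1) q (ins (letter 2 b) f) g s +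
  conv p (q + 1) (fun u => eps u *: f u) (ins (letter 2 b) g) s.
Proof.
rewrite ins_cut -cutD; apply: eq_cut => u v _; congr (_ + _).
  apply: (ins_graded b p (F := fun e x => pmul e (dg q v) x (g v))) => e.
  exact: pmul_linearl.
rewrite (linear_funZ _ _ (pmul_linearl _ _ _)); congr (_ *: _).
apply: (ins_graded b q (F := fun e x => pmul (dg p u) e (f u) x)) => e.
exact: pmul_linearr.
Qed.

Lemma mlin_conv p q f g : mlin f -> mlin g -> mlin (conv p q f g).
Proof.
move=> flin glin; apply: mlin_cut => [v|u] s1 s2 i a x y.
  rewrite flin (dg_mid p x (a *: x + y)) (dg_mid p y (a *: x + y)).
  exact: pmul_linearl.
rewrite glin (dg_mid q x (a *: x + y)) (dg_mid q y (a *: x + y)).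
exact: pmul_linearr.
Qed.

End Convolution.

Lemma pullback_conv (k : fieldType) (V W : graded k) (A : dga k)
    (f : seq (homog V) -> tot W) p q (g h : seq (homog W) -> tot A) s :
  pullback (letter 1 f) (conv p q g h) s =
  conv p q (pullback (letter 1 f) g) (pullback (letter 1 f) h) s.
Proof.
rewrite pullback_cut; apply: eq_cut => u v _.
rewrite -(pullback_graded f p (F := fun e x => pmul e (dg q v) x
   (pullback (letter 1 f) h v))); last by move=> e; exact: pmul_linearl.
apply: eq_blocks_sum => c _.
apply: (pullback_graded f q (F := fun e x => pmul _ e _ x)) => e.
exact: pmul_linearr.
Qed.

Section Supports.
Variables (k : fieldType) (V W : graded k).
Implicit Types (s : seq (homog V)).

Lemma tot_cutE (P : seq (homog V) -> seq (homog V) -> tot W) s e :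
  cut P s e = cut (fun u v => P u v e) s.
Proof. exact: (linear_cut _ _ (@tot_eval_linear _ W e)). Qed.

Lemma supp_ins (b : seq (homog V) -> tot V) c (f : seq (homog V) -> tot W) :
  supp c f -> supp (c + 1) (ins (letter 2 b) f).
Proof.
move=> fs s e ne; rewrite /ins tot_cutE; apply: cut0 => u w suw.
rewrite (linear_funZ _ _ (@tot_eval_linear _ W e)) /head_ins tot_cutE.
rewrite cut0 ?scaler0 // => p q wpq; case: ifP => // _; apply: fs.
apply: contra ne => /eqP->; rewrite suw wpq.
by rewrite /dg !(degs_cat, degs_cons, size_cat) /= /dg; apply/eqP; lia.
Qed.

Lemma supp_conv (A : dga k) p q (f g : seq (homog V) -> tot A) :
  supp (p + q) (conv p q f g).
Proof.
move=> s e ne; rewrite /conv (linear_cut _ _ (@tot_eval_linear _ A e)).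
by apply: cut0 => u v suv; rewrite pmul_supp // dgD -suv.
Qed.

Lemma supp_pullback (Z : graded k) c (f : seq (homog V) -> tot W)
    (g : seq (homog W) -> tot Z) :
  supp c g -> supp c (pullback (letter 1 f) g).
Proof.
move=> gs s e ne.
rewrite /pullback (linear_blocks_sum _ _ (@tot_eval_linear _ Z e)).
rewrite -[RHS](blocks_sum0 (Z e) s).
by apply: eq_blocks_sum => bs bss; rewrite gs // dg_letters bss.
Qed.

End Supports.

(** Cancels the last summand t, after moving its opposite next to it; for the
    first pattern this exchanges the two, whence [subrK]. *)
Ltac zmod_cancel_last :=
  match goal with
  | |- _ + - ?t = _ => rewrite !(addrAC _ t) subrK
  | |- _ + ?t = _ => rewrite !(addrAC _ (- t)) addrK
  end.

Ltac zmod_solve :=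
  apply/eqP; rewrite -subr_eq0; apply/eqP;
  rewrite ?(opprD, opprK) -[LHS]add0r ?addrA; repeat zmod_cancel_last; by [].

(** * The obstructions to twisting cochains and gauge homotopies *)

Section Obstructions.
Variables (k : fieldType) (V : graded k) (A : dga k).
Variable b : seq (homog V) -> tot V.
Hypothesis b_norm : forall s, (size s <= 1)%N -> b s = 0.
Implicit Types s u v w : seq (homog V).

Let ieps (f : seq (homog V) -> tot A) w : tot A := eps w *: f w.
Let D (f : seq (homog V) -> tot A) : seq (homog V) -> tot A :=
  ins (letter 2 b) f.

Let iepsK f w : ieps (ieps f) w = f w.
Proof. by rewrite /ieps scalerA epsK scale1r. Qed.

Let tdiff_ieps f w : tdiff (ieps f w) = eps w *: tdiff (f w).
Proof. exact: tdiffZ. Qed.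

Let D_ieps f w : D (ieps f) w = - ieps (D f) w.
Proof. exact: ins_eps. Qed.

Let ieps_conv p q f g w : ieps (conv p q f g) w = conv p q (ieps f) (ieps g) w.
Proof. exact: eps_conv. Qed.

Let D_conv p q f g w :
  D (conv p q f g) w =
    conv (p + 1) q (D f) g w + conv p (q + 1) (ieps f) (D g) w.
Proof. exact: ins_conv. Qed.

Let tdiff_conv1 q f g s :
  tdiff (conv 1 q f g s) =
  conv 2 q (fun u => tdiff (f u)) g s -
  conv 1 (q + 1) (ieps f) (fun u => tdiff (g u)) s.
Proof. by rewrite tdiff_conv expr1z scaleN1r. Qed.

Let tdiff_conv0 q f g s :
  tdiff (conv 0 q f g s) =
  conv 1 q (fun u => tdiff (f u)) g s +
  conv 0 (q + 1) (ieps f) (fun u => tdiff (g u)) s.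
Proof. by rewrite tdiff_conv expr0z scale1r. Qed.

Let DN f w : D (fun v => - f v : tot A) w = - D f w.
Proof.
rewrite /D (linear_ins (letter 2 b) f w (g := -%R)) // => a x y.
by rewrite opprD scalerN.
Qed.

Let DD f g w : D (fun v => f v + g v) w = D f w + D g w.
Proof. exact: insD. Qed.

(** [d f = twisting f] is the Maurer-Cartan equation of the convolution algebra;
    its solutions are the A-infinity morphisms to A. *)
Definition twisting (f : seq (homog V) -> tot A) w : tot A :=
  ins (letter 2 b) f w - conv 1 1 (fun u => eps u *: f u) f w.

(** A Bianchi identity. After substituting the equation for shorter words, the triple products
    cancel by associativity and the products with [D f] by the Leibniz rules; what is left is
    [D (D f) s]. *)
Lemma tdiff_twisting (f : seq (homog V) -> tot A) s :
  mlin f -> f [::] = 0 ->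
  (forall v, (size v < size s)%N -> tdiff (f v) = twisting f v) ->
  (forall v, (size v < size s)%N -> ins (letter 2 b) b v = 0) ->
  tdiff (twisting f s) = f [:: letter 3 (ins (letter 2 b) b) s].
Proof.
move=> flin f0 df Q0.
have Df : tdiff (D f s) = D (twisting f) s.
  rewrite (linear_ins (letter 2 b) f s (@tdiff_linear _ A)).
  by apply: eq_ins => v vs _; exact: df.
have c1 : conv 2 1 (fun u => tdiff (ieps f u)) f s =
          conv 2 1 (fun u => ieps (D f) u - ieps (conv 1 1 (ieps f) f) u) f s.
  apply: eq_convl => // u us.
  by rewrite tdiff_ieps df // scalerBr.
have c2 : conv 1 2 (ieps (ieps f)) (fun u => tdiff (f u)) s =
          conv 1 2 f (fun u => D f u - conv 1 1 (ieps f) f u) s.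
  rewrite (@eq_conv _ _ _ _ _ _ f _ (fun u => tdiff (f u))) //.
  by apply: eq_convr => // u us; rewrite df.
have c3 : conv 2 1 (ieps (conv 1 1 (ieps f) f)) f s =
          conv 1 2 f (conv 1 1 (ieps f) f) s.
  rewrite (convA 1 1 1) /=; apply: eq_conv => // u.
  by rewrite ieps_conv; exact: eq_conv.
have c4 : D (conv 1 1 (ieps f) f) s =
          - conv 2 1 (ieps (D f)) f s + conv 1 2 f (D f) s.
  rewrite D_conv; congr (_ + _); last exact: eq_conv.
  by rewrite -convNl; exact: eq_conv.
rewrite /twisting tdiffD tdiffN tdiff_conv1 -/(D f) Df c1 c2.
rewrite /twisting DD DN c4 -/(D f) convDl convNl convDr convNr c3.
rewrite -(ins_ins_top b_norm flin Q0) -/(D f) -/(D (D f)).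
zmod_solve.
Qed.

(** The homotopy equation [d eta = gauge eta] says that 1 + eta is a gauge
    transformation from the twisting cochain [rho] to [tau]. *)
Definition gauge (tau rho eta : seq (homog V) -> tot A) w : tot A :=
  - ins (letter 2 b) eta w - conv 1 0 tau eta w +
  conv 0 1 (fun u => eps u *: eta u) rho w - tau w + rho w.

(** All terms cancel by the Maurer-Cartan equations of [tau] and [rho]. The error x of [rho] at s
    enters once, through the summand [rho s]: in the products [rho] meets only shorter words because
    eta is zero on the empty one. *)
Lemma tdiff_gauge (tau rho eta : seq (homog V) -> tot A) (x : tot A) s :
  mlin eta -> tau [::] = 0 -> rho [::] = 0 -> eta [::] = 0 ->
  (forall w, ins (letter 2 b) b w = 0) ->
  (forall w, tdiff (tau w) = twisting tau w) ->
  (forall w, (size w < size s)%N -> tdiff (rho w) = twisting rho w) ->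
  tdiff (rho s) = twisting rho s - x ->
  (forall w, (size w < size s)%N -> tdiff (eta w) = gauge tau rho eta w) ->
  tdiff (gauge tau rho eta s) = - x.
Proof.
move=> etalin tau0 rho0 eta0 Q0 dtau drho drhos deta.
have DDeta : D (D eta) s = 0.
  rewrite /D (ins_ins_top b_norm) //.
  by rewrite /letter Q0 (mlin0 [::] [::] _ etalin).
have Deta : tdiff (D eta s) = D (gauge tau rho eta) s.
  rewrite (linear_ins (letter 2 b) eta s (@tdiff_linear _ A)).
  by apply: eq_ins => v vs _; exact: deta.
have d1 : conv 2 0 (fun u => tdiff (tau u)) eta s =
    conv 2 0 (D tau) eta s - conv 2 0 (conv 1 1 (ieps tau) tau) eta s.
  rewrite -convNl -convDl; exact: eq_conv.
have d2 : conv 1 1 (ieps tau) (fun u => tdiff (eta u)) s =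
    conv 1 1 (ieps tau) (gauge tau rho eta) s.
  by apply: eq_convr => [u us|]; rewrite ?deta // /ieps tau0 scaler0.
have d3 : conv 1 1 (fun u => tdiff (ieps eta u)) rho s =
    conv 1 1 (ieps (gauge tau rho eta)) rho s.
  by apply: eq_convl => // u us; rewrite tdiff_ieps deta.
have d4 : conv 0 2 (ieps (ieps eta)) (fun u => tdiff (rho u)) s =
    conv 0 2 eta (D rho) s - conv 0 2 eta (conv 1 1 (ieps rho) rho) s.
  rewrite -convNr -convDr (@eq_conv _ _ _ _ _ _ eta _ (fun u =>
    tdiff (rho u))) //.
  by apply: eq_convr => // u us; rewrite drho.
have e2 : conv 1 1 (ieps tau) (gauge tau rho eta) s =
    - conv 1 1 (ieps tau) (D eta) s - conv 2 0 (conv 1 1 (ieps tau) tau) eta s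
    + conv 1 1 (ieps tau) (conv 0 1 (ieps eta) rho) s
    - conv 1 1 (ieps tau) tau s + conv 1 1 (ieps tau) rho s.
  by rewrite /gauge !convDr !convNr (convA 1 1 0).
have e3 : conv 1 1 (ieps (gauge tau rho eta)) rho s =
    - conv 1 1 (ieps (D eta)) rho s
    - conv 1 1 (ieps tau) (conv 0 1 (ieps eta) rho) s
    + conv 0 2 eta (conv 1 1 (ieps rho) rho) s
    - conv 1 1 (ieps tau) rho s + conv 1 1 (ieps rho) rho s.
  rewrite (convA 1 0 1) (convA 0 1 1) /=.
  rewrite -!convNl -!convDl; apply: eq_conv => // u.
  rewrite /ieps /gauge !scalerDr !scalerN; congr (_ - _ + _ - _ + _).
    exact: eps_conv.
  by rewrite eps_conv; apply: eq_conv => // w; exact: iepsK.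
have e5 : D (gauge tau rho eta) s =
    - conv 2 0 (D tau) eta s - conv 1 1 (ieps tau) (D eta) s
    - conv 1 1 (ieps (D eta)) rho s + conv 0 2 eta (D rho) s
    - D tau s + D rho s.
  rewrite /gauge /D !insD -/(D _) !DN -!/(D _) DDeta oppr0 add0r.
  rewrite !DN !D_conv opprD addrA; congr (_ + _ + _ - _ + _).
    by rewrite -convNl; apply: eq_conv => // w; exact: D_ieps.
  by apply: eq_conv => // w; exact: iepsK.
rewrite {1}/gauge !tdiffD !tdiffN -/(D eta) Deta tdiff_conv1 tdiff_conv0.
rewrite d1 d2 d3 d4 e2 e3 e5 dtau drhos /twisting -/(D tau) -/(D rho).
zmod_solve.
Qed.

End Obstructions.

(** * Linear splittings of a complex and recursion on word length *)

Lemma dependent_choice_fun (I : Type) (T : I -> Type)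
    (P : forall i, T i -> Prop) :
  (forall i, exists x, P i x) -> exists f, forall i, P i (f i).
Proof. by move=> H; exists (fun i => projT1 (cid (H i))) => i; case: cid. Qed.

Section Retraction.
Variables (k : fieldType) (C : complex k).

Lemma linear_extension_of (U V : lmodType k) (g : U -> V) :
  linear g -> {gl : {linear U -> V} | gl =1 g}.
Proof.
move=> glin; pose glM := GRing.isLinear.Build k U V *:%R g glin.
by exists (HB.pack g glM : {linear U -> V}).
Qed.

Lemma coho_class_linear e : linear (@coho_class k C e : _ -> coho C e).
Proof. by move=> a x y; rewrite coho_classD coho_classZ. Qed.

(** The class map extends from cocycles to all cochains through a linear retraction onto the
    cocycles. *)
Lemma coho_projection :
  exists p : forall e, {linear C e -> coho_complex C e},
    forall e (z : cocycle C e), p e (cocycle_val z) = coho_class z.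
Proof.
suff /dependent_choice_fun[p pP] : forall e,
  exists p : {linear C e -> coho_complex C e},
    forall z : cocycle C e, p (cocycle_val z) = coho_class z by exists p.
move=> e.
have [v vE] := linear_extension_of (@cocycle_val_linear k C e).
have [g gP] := linear_quasi_inverse v.
have [|q qE] := @linear_extension_of _ (coho_complex C e) (fun x =>
  coho_class (g x)).
  by move=> a x y; rewrite linearP; exact: coho_class_linear.
exists q => z; rewrite qE; congr coho_class; apply: val_inj.
by move: (gP z); rewrite !vE.
Qed.

Lemma coho_section :
  exists iota : forall e, {linear coho_complex C e -> C e},
    forall e x, represents (iota e x) x.
Proof.
suff /dependent_choice_fun[i iP] : forall e,
  exists i : {linear coho_complex C e -> C e},
    forall x, represents (i x) x by exists i.
move=> e.
have [c cE] := linear_extension_of (@coho_class_linear e).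
have [g gP] := linear_quasi_inverse c.
have [|i iE] := @linear_extension_of (coho_complex C e) _ (fun x =>
  cocycle_val (g x)).
  by move=> a x y; rewrite linearP cocycle_val_linear.
exists i => x; rewrite iE; exists (g x) => //.
by elim/coho_class_ind: x => z; move: (gP z); rewrite !cE.
Qed.

(** On coboundaries h is a linear choice of primitives; linearity in turn keeps the new components
    of f and eta multilinear. *)
Lemma diff_homotopy :
  exists h : forall e, {linear C (e + 1) -> C e},
    forall e y, diff C e (h e (diff C e y)) = diff C e y.
Proof.
suff /dependent_choice_fun[h hP] : forall e,
  exists h : {linear C (e + 1) -> C e},
    forall y, diff C e (h (diff C e y)) = diff C e y by exists h.
by move=> e; exact: linear_quasi_inverse.
Qed.

Lemma represents_diff e (x : C e) h : represents x h -> diff C e x = 0.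
Proof. by case=> z <- _; apply/eqP; exact: cocycle_valP. Qed.

Variable p : forall e, {linear C e -> coho_complex C e}.
Hypothesis pP : forall e (z : cocycle C e), p e (cocycle_val z) = coho_class z.

Lemma proj_represents e (x : C e) h : represents x h -> p e x = h.
Proof. by case=> z <- <-; exact: pP. Qed.

Definition cocycle_of e (x : C e) (dx : diff C e x = 0) : cocycle C e :=
  Cocycle (introT eqP dx : x \in cocycle_pred (i:=e)).

Lemma proj_diff e (y : C e) : p (e + 1) (diff C e y) = 0.
Proof.
rewrite -[diff C e y]/(cocycle_val (cocycle_of (diffK y))) pP.
rewrite -(linear_fun0 (@coho_class_linear (e + 1))).
apply/coho_classP; rewrite subr0; apply/asboolP.
by exists e, y.
Qed.

Lemma proj_exact e (x : C (e + 1)) :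
  diff C (e + 1) x = 0 -> p (e + 1) x = 0 -> exists y, x = diff C e y.
Proof.
move=> dx; rewrite -[x]/(cocycle_val (cocycle_of dx)) pP.
rewrite -(linear_fun0 (@coho_class_linear (e + 1))) => /coho_classP.
rewrite subr0 => /asboolP[j [y]] /= xy.
have je : e = j by apply: (addIr 1); exact: (congr1 tag xy).
case: j / je y xy => y xy; exists y.
by rewrite -(component_id x) xy component_id.
Qed.

Variable h : forall e, {linear C (e + 1) -> C e}.
Hypothesis hP : forall e y, diff C e (h e (diff C e y)) = diff C e y.

Definition tproj (x : tot C) : tot (coho_complex C) := fun e => p e (x e).
Definition thom (x : tot C) : tot C := fun e => h e (x (e + 1)).

Lemma tproj_linear : linear tproj.
Proof. by move=> a x y; apply: totP => e; exact: linearP. Qed.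

Lemma thom_linear : linear thom.
Proof. by move=> a x y; apply: totP => e; exact: linearP. Qed.

Lemma tproj_tdiff x : tproj (tdiff x) = 0.
Proof.
by apply: totP => e; rewrite -(subrK 1 e) /tproj tdiffE proj_diff.
Qed.

(** A cocycle of class zero is exact, and d h is the identity on coboundaries. This solves the
    equation of each new arity. *)
Lemma tdiff_thom x : tdiff x = 0 -> tproj x = 0 -> tdiff (thom x) = x.
Proof.
move=> dx px; apply: totP => e; rewrite -(subrK 1 e) tdiffE.
have [||y xy] := @proj_exact (e - 1) (x (e - 1 + 1)).
- by rewrite -tdiffE dx.
- exact: (congr1 (fun y : tot (coho_complex C) => y (e - 1 + 1)) px).
- by rewrite /thom xy hP.
Qed.

End Retraction.

(** The limit takes at s the value of stage [size s]. It agrees with stage n only on words of length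
    at most n, which suffices for conditions that are local in the length. *)
Lemma word_recursion (T X : Type) (P : nat -> (seq T -> X) -> Prop) :
  (exists F, P 0 F) ->
  (forall n F, P n F -> exists2 F', P n.+1 F' &
     forall s, (size s <= n)%N -> F' s = F s) ->
  exists F, forall n, exists2 F', P n F' &
     forall s, (size s <= n)%N -> F s = F' s.
Proof.
move=> [F0 PF0] step.
(* The step is made total for [choice]: where P fails, F is returned unchanged. *)
have /choice[next nextP] : forall nF : nat * (seq T -> X), exists F',
    P nF.1 nF.2 -> P nF.1.+1 F' /\
      forall s, (size s <= nF.1)%N -> F' s = nF.2 s.
  move=> [n F]; have [PF|nPF] := pselect (P n F).
    by have [F' ? ?] := step n F PF; exists F'.
  by exists F.
pose stage := fix stage n := if n is m.+1 then next (m, stage m) else F0.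
have stageP n : P n (stage n).
  by elim: n => //= n IHn; have [] := nextP (n, stage n) IHn.
have stageS n m s : (size s <= n)%N -> (n <= m)%N -> stage m s = stage n s.
  move=> sn; elim: m => [|m IHm]; first by rewrite leqn0 => /eqP->.
  rewrite leq_eqVlt => /predU1P[->//|]; rewrite ltnS => nm.
  rewrite /= -IHm //; have [_] := nextP (m, stage m) (stageP m); apply.
  exact: leq_trans nm.
exists (fun s => stage (size s) s) => n; exists (stage n) => // s sn.
by rewrite (stageS (size s) n).
Qed.

(** * Dependence on short words and the effect of top-length corrections *)

Section Locality.
Variables (k : fieldType) (V : graded k).
Implicit Types s u v : seq (homog V).

Lemma eq_ins_letter (X : lmodType k) (b b' : seq (homog V) -> tot V)
    (f f' : seq (homog V) -> X) s :
  (forall v, (size v <= size s)%N -> b v = b' v) ->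
  (forall v, (size v <= size s)%N -> f v = f' v) ->
  ins (letter 2 b) f s = ins (letter 2 b') f' s.
Proof.
move=> bb ff; rewrite (@eq_ins _ _ _ _ f f') => [|v vs _]; last exact/ff/ltnW.
apply: eq_cut => u w suw; congr (_ *: _); apply: eq_cut => p q wpq.
by rewrite /letter bb // suw wpq !size_cat; lia.
Qed.

(** A contraction by c is nonzero only when the block is all of s. *)
Lemma ins_perturb (X : lmodType k) (b c : seq (homog V) -> tot V)
    (f : seq (homog V) -> X) s :
  mlin f -> (1 < size s)%N -> (forall v, (size v < size s)%N -> c v = 0) ->
  ins (letter 2 (fun v => b v + c v)) f s =
  ins (letter 2 b) f s + f [:: letter 2 c s].
Proof.
move=> flin s1 c0.
have -> : ins (letter 2 (fun v => b v + c v)) f s =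
    ins (letter 2 b) f s + ins (letter 2 c) f s.
  rewrite -cutD; apply: eq_cut => u w _; rewrite -scalerDr -cutD.
  congr (_ *: _); apply: eq_cut => p q _; case: ifP => _; last by rewrite addr0.
  have := flin u q _ 1 (b p (dg 2 p)) (c p (dg 2 p)).
  by rewrite !scale1r.
congr (_ + _); case: s s1 c0 => // x s s1 c0.
have f0 u v t : (size v < size (x :: s))%N -> f (u ++ letter 2 c v :: t) = 0.
  by move=> vs; rewrite /letter c0 // mlin0.
rewrite ins_cons /head_ins cut_last => [|v t svt t0]; last first.
  by case: ifP => // _; apply: (f0 [::]); rewrite svt size_cat; lia.
rewrite s1 [X in _ + _ *: X]cut0 ?scaler0 ?addr0 // => u w suw.
rewrite [head_ins _ _ _]cut0 ?scaler0 // => v t wvt; case: ifP => // _.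
by apply: (f0 (x :: u)); rewrite /= suw wvt !size_cat; lia.
Qed.

Variable W : graded k.

Lemma map_letter_flatten (f f' : seq (homog V) -> tot W) c n :
  (forall v, (size v <= n)%N -> f v = f' v) -> (size (flatten c) <= n)%N ->
  map (letter 1 f) c = map (letter 1 f') c.
Proof.
move=> ff; elim: c => //= v c IHc; rewrite size_cat => vc.
by rewrite IHc ?/letter ?ff //; lia.
Qed.

Lemma eq_pullback (X : nmodType) (f f' : seq (homog V) -> tot W)
    (g : seq (homog W) -> X) s :
  (forall v, (size v <= size s)%N -> f v = f' v) ->
  pullback (letter 1 f) g s = pullback (letter 1 f') g s.
Proof.
move=> ff; apply: eq_blocks_sum => c cs; congr g.
by apply: map_letter_flatten ff _; rewrite cs.
Qed.

(** The decomposition of s into a single block is the only one to feel c. *)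
Lemma pullback_perturb (X : lmodType k) (f c : seq (homog V) -> tot W)
    (g : seq (homog W) -> X) s :
  mlin g -> (0 < size s)%N -> (forall v, (size v < size s)%N -> c v = 0) ->
  pullback (letter 1 (fun v => f v + c v)) g s =
  pullback (letter 1 f) g s + g [:: letter 1 c s].
Proof.
move=> glin s0 c0; rewrite !pullbackE //.
pose P u v : X := if v is [::] then
  if u is [::] then 0 else g [:: letter 1 c u] else 0.
have <- : cut P s = g [:: letter 1 c s].
  by rewrite cut_last => [|u [|x v]] //; case: (s) s0.
rewrite -cutD; apply: eq_cut => -[|x u] [|y v] suv; rewrite /P ?addr0 //.
  have := glin [::] [::]
    _ 1 (f (x :: u) (dg 1 (x :: u))) (c (x :: u) (dg 1 (x :: u))).
  by rewrite !scale1r.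
rewrite (@eq_pullback _ _ f) => [|w wv]; last first.
  by rewrite c0 ?addr0 // suv size_cat /=; move: wv => /=; lia.
apply: eq_blocks_sum => d _; congr (g (_ :: _)).
by rewrite /letter c0 ?addr0 // suv size_cat /=; lia.
Qed.

Lemma mlin_at_length (X : lmodType k) n (f : seq (homog V) -> X) :
  mlin f -> mlin (fun s => if size s == n then f s else 0).
Proof.
move=> flin s1 s2 i a x y; rewrite !size_cat /=.
by case: ifP => _; rewrite ?scaler0 ?addr0.
Qed.

Lemma mlinN (X : lmodType k) (f : seq (homog V) -> X) :
  mlin f -> mlin (fun s => - f s).
Proof. by move=> flin s1 s2 i a x y; rewrite flin opprD scalerN. Qed.

End Locality.

(** * Existence: arity-by-arity construction of the model *)

Section BarModels.
Variables (k : fieldType) (A : dga k).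
Let H := coho_complex A.
Variable p : forall e, {linear A e -> H e}.
Hypothesis pP : forall e (z : cocycle A e), p e (cocycle_val z) = coho_class z.
Variable h : forall e, {linear A (e + 1) -> A e}.
Hypothesis hP : forall e y, diff A e (h e (diff A e y)) = diff A e y.
Implicit Types (s u v : seq (homog H)).

Lemma eq_twisting (b b' : seq (homog H) -> tot H)
    (f f' : seq (homog H) -> tot A) s :
  (forall v, (size v <= size s)%N -> b v = b' v) ->
  (forall v, (size v <= size s)%N -> f v = f' v) ->
  twisting b f s = twisting b' f' s.
Proof.
move=> bb ff; rewrite /twisting (eq_ins_letter bb ff); congr (_ - _).
by apply: eq_cut => u v suv; rewrite !ff // suv size_cat; lia.
Qed.

(** Thus [mor_eq] in arity one says that f_1 takes values in cocycles. *)
Lemma twisting1 (b : seq (homog H) -> tot H) (f : seq (homog H) -> tot A) x :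
  f [::] = 0 -> twisting b f [:: x] = 0.
Proof.
move=> f0; rewrite /twisting ins1 /conv cut_cons cut_nil f0.
rewrite (linear_fun0 (pmul_linearr _ _ _)) scaler0.
by rewrite (linear_fun0 (pmul_linearl _ _ _)) addr0 subrr.
Qed.

(** The bar form of an A-infinity structure b on cohomology together with a
    morphism f to A, subject to the morphism equation in the arities in D. *)
Record bar_model (D : pred nat) (b : seq (homog H) -> tot H)
    (f : seq (homog H) -> tot A) : Prop := BarModel {
  bar_lin : mlin b;
  bar_supp : supp 2 b;
  bar_norm : forall s, (size s <= 1)%N -> b s = 0;
  mor_lin : mlin f;
  mor_supp : supp 1 f;
  mor_nil : f [::] = 0;
  mor_proj : forall i (x : H i), p i (f [:: hmk x] i) = x;
  mor_eq : forall s, D (size s) -> tdiff (f s) = twisting b f s }.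

Lemma mor_letter D b f c s (y : seq (homog H) -> tot H) : bar_model D b f ->
  supp c y -> tproj p (f [:: letter c y s]) = y s.
Proof.
move=> M ys; apply: totP => e; rewrite /tproj /letter.
have [->|ne] := eqVneq e (dg c s); first exact: (mor_proj M).
rewrite (mor_supp M) ?linear0; first by rewrite ys.
by rewrite /dg degs_cons degs_nil subrr !addr0.
Qed.

Lemma tdiff_letter D b f c s (y : seq (homog H) -> tot H) : bar_model D b f ->
  D 1%N -> tdiff (f [:: letter c y s]) = 0.
Proof.
by move=> M D1; rewrite (mor_eq M) // twisting1 //; exact: mor_nil M.
Qed.

(** Strong induction on length gives the shorter relations. Then d of the right-hand side is f_1 of
    the relation at s; p sends it to 0 as a coboundary and to the relation itself since p f_1 =
    id. *)
Lemma twisting_closed D b f s : bar_model D b f ->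
  (forall n, (n < size s)%N -> D n) ->
  ins (letter 2 b) b s = 0 /\ tdiff (twisting b f s) = 0.
Proof.
move=> M; have [n] := ubnP (size s); elim: n s => // n IHn s ltn Ds.
have dU : tdiff (twisting b f s) = f [:: letter 3 (ins (letter 2 b) b) s].
  apply: tdiff_twisting;
    [exact: bar_norm M|exact: mor_lin M|exact: mor_nil M| |].
    by move=> v vs; apply: (mor_eq M); exact: Ds.
  move=> v vs; apply: (proj1 (IHn v _ _)); first exact: leq_trans vs _.
  by move=> m mv; apply: Ds; exact: ltn_trans vs.
suff Q0 : ins (letter 2 b) b s = 0.
  by split=> //; rewrite dU /letter Q0 (mlin0 [::] [::] _ (mor_lin M)).
rewrite -(mor_letter s M (supp_ins b (bar_supp M))) -dU.
exact: tproj_tdiff pP _.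
Qed.

Lemma bar_model_step n b f : (0 < n)%N -> bar_model (leq^~ n) b f ->
  exists b' f', bar_model (leq^~ n.+1) b' f' /\
    forall s, (size s <= n)%N -> b' s = b s /\ f' s = f s.
Proof.
move=> n0 M; pose U := twisting b f.
(* y is the class of U: adding - y to b leaves the exact remainder U', and h of it is the new value
   of f. Both corrections live in length n + 1 only; g also erases whatever f was there. *)
pose y s := tproj p (U s).
pose U' s := U s - f [:: letter 2 y s].
pose c s := if size s == n.+1 then - y s else 0.
pose g s := if size s == n.+1 then thom h (U' s) - f s else 0.
have c0 s : (size s <= n)%N -> c s = 0.
  by move=> sn; rewrite /c; case: eqP => // sE; move: sn; rewrite sE ltnn.
have g0 s : (size s <= n)%N -> g s = 0.
  by move=> sn; rewrite /g; case: eqP => // sE; move: sn; rewrite sE ltnn.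
have Usupp : supp 2 U.
  move=> s e ne; rewrite /U /twisting.
  have -> : (ins (letter 2 b) f s - conv 1 1 (fun u => eps u *: f u) f s) e =
    ins (letter 2 b) f s e - conv 1 1 (fun u => eps u *: f u) f s e by [].
  by rewrite (supp_ins b (mor_supp M)) // supp_conv // subr0.
have Ulin : mlin U.
  apply: mlinD; first by apply: mlin_ins; [exact: bar_lin M|exact: mor_lin M].
  apply/mlinN/mlin_conv; last exact: mor_lin M.
  exact/mlin_eps/(mor_lin M).
have ylin : mlin y by apply: mlin_linear Ulin; exact: tproj_linear.
have ysupp : supp 2 y by move=> s e ne; rewrite /y /tproj Usupp ?linear0.
have U'lin : mlin U'.
  apply: mlinD => //; apply: mlinN.
  exact: (mlin_letter 2 [::] [::] ylin (mor_lin M)).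
have U'supp : supp 2 U'.
  move=> s e ne; rewrite /U' -[LHS]/(U s e - f [:: letter 2 y s] e).
  by rewrite Usupp // (mor_supp M) ?subr0 // /dg degs_cons degs_nil subrr
    !addr0.
(* At length n + 1 the right-hand side ignores g, and c enters only as f_1 (c s), which is - f_1 (y
   s). *)
have U'E s : size s = n.+1 ->
    twisting (fun v => b v + c v) (fun v => f v + g v) s = U' s.
  move=> sn; rewrite /twisting /U' /U /twisting.
  rewrite (@eq_ins _ _ _ _ _ f) => [|v]; last first.
    by rewrite sn ltnS => vn _; rewrite g0 // addr0.
  rewrite (ins_perturb b (mor_lin M)); [|lia|by move=> v; rewrite sn;
    exact: c0].
  rewrite addrAC; congr (_ + _ + _).
    congr (- _); rewrite (@eq_convl _ _ _ _ _ _ (fun u => eps u *: f u)).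
    - apply: eq_convr => [v vs|]; first by rewrite g0 ?addr0 // -ltnS -sn.
      by rewrite (mor_nil M) scaler0.
    - by move=> v vs; rewrite g0 ?addr0 // -ltnS -sn.
    - by rewrite (mor_nil M) g0 // addr0.
  rewrite /letter /c sn eqxx; have flin : mlin f := mor_lin M.
  have := flin [::] [::] _ (-1) (y s (dg 2 s)) 0.
  by rewrite /= !scaleN1r addr0 (mlin0 [::] [::] _ flin) addr0.
exists (fun v => b v + c v), (fun v => f v + g v); split; last first.
  by move=> s sn; rewrite c0 // g0 // !addr0.
split.
- by apply: mlinD; [exact: bar_lin M|exact/mlin_at_length/mlinN].
- move=> s e ne; rewrite -[LHS]/(b s e + c s e) (bar_supp M) // add0r /c.
  by case: ifP => // _; rewrite -[LHS]/(- (y s e)) ysupp ?oppr0.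
- by move=> s s1; rewrite (bar_norm M) // c0 ?addr0 //; exact: leq_trans s1 n0.
- apply: mlinD; first exact: mor_lin M.
  apply/mlin_at_length/mlinD; last exact/mlinN/(mor_lin M).
  by apply: mlin_linear U'lin; exact: thom_linear.
- move=> s e ne; rewrite -[LHS]/(f s e + g s e) (mor_supp M) // add0r /g.
  case: ifP => // _; rewrite -[LHS]/(thom h (U' s) e - f s e) (mor_supp M) //
    subr0.
  rewrite /thom U'supp ?linear0 //.
  by apply: contra ne => /eqP E; apply/eqP; move: E; rewrite /dg; lia.
- by rewrite (mor_nil M) g0 ?addr0.
- by move=> i x; rewrite g0 // addr0 (mor_proj M).
- move=> s; rewrite leq_eqVlt => /orP[/eqP sn|sn].
    rewrite U'E // /g sn eqxx addrC subrK.
    have [_ dU] : ins (letter 2 b) b s = 0 /\ tdiff (U s) = 0.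
      by apply: twisting_closed M _ => m; rewrite sn.
    apply: (tdiff_thom pP hP).
      by rewrite /U' tdiffD tdiffN dU (tdiff_letter 2 s y M) // subrr.
    have := tproj_linear p (-1) (f [:: letter 2 y s]) (U s).
    rewrite !scaleN1r (mor_letter s M ysupp) -/(y s) addNr.
    by rewrite /U' [U s - _]addrC.
  rewrite g0 // addr0 (mor_eq M) //; apply: eq_twisting => v vs.
    by rewrite c0 ?addr0 //; exact: leq_trans vs sn.
  by rewrite g0 ?addr0 //; exact: leq_trans vs sn.
Qed.

End BarModels.

Section BarExistence.
Variables (k : fieldType) (A : dga k).
Let H := coho_complex A.
Variable p : forall e, {linear A e -> H e}.
Hypothesis pP : forall e (z : cocycle A e), p e (cocycle_val z) = coho_class z.
Variable h : forall e, {linear A (e + 1) -> A e}.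
Hypothesis hP : forall e y, diff A e (h e (diff A e y)) = diff A e y.
Implicit Types (s u v : seq (homog H)).

Lemma bar_model_exists : exists b f, bar_model p predT b f.
Proof.
have [iota iotaP] := coho_section A.
(* In arity one, f is a linear choice of representatives and b is zero; the recursion supplies all
   longer words. *)
pose f1 s : tot A := if s is [:: x] then
  fun e => component (hmk (iota (tag x) (tagged x))) e else 0.
have init : bar_model p (leq^~ 1%N) (fun=> 0) f1.
  split=> //.
  - by move=> s1 s2 i a x y; rewrite scaler0 addr0.
  - move=> [|z [|z' s1]] [|w s2] i a x y; rewrite /= ?scaler0 ?addr0 //.
    apply: totP => e; rewrite /= linearP component_linear //.
  - move=> [|x [|y s]] e //= ne; apply: component_neq.
    by apply: contra ne => /eqP <-; rewrite /dg degs_cons degs_nil subrr !addr0.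
  - by move=> i x; rewrite /f1 component_id; exact/(proj_represents pP)/iotaP.
  - move=> [|x [|y s]] // _.
      by rewrite /twisting ins_nil conv_nil ?scaler0 // subrr tdiff0.
    rewrite twisting1 //; apply: totP => e; rewrite -(subrK 1 e) tdiffE /=.
    have [<-|ne] := eqVneq (tag x) (e - 1).
      by rewrite component_id (represents_diff (iotaP _ _)).
    by rewrite component_neq // linear0.
(* Stage n covers arities up to n + 1, since the induction step needs arity one to be settled
   already. *)
have [||F FP] := @word_recursion (homog H) (tot H * tot A)
  (fun n F => bar_model p (leq^~ n.+1) (fun s => (F s).1) (fun s => (F s).2)).
- by exists (fun s => (0, f1 s)).
- move=> n F /(bar_model_step pP hP (ltn0Sn n)) [b [f [M bf]]].
  exists (fun s => (b s, f s)) => // s sn.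
  by have [-> ->] := bf s (leqW sn); case: (F s).
exists (fun s => (F s).1), (fun s => (F s).2); split.
- move=> s1 s2 i a x y; have [G M FG] := FP (size (s1 ++ hmk x :: s2)).
  by rewrite !FG ?(bar_lin M) // !size_cat.
- by move=> s e ne; have [G M ->] := FP (size s); rewrite // (bar_supp M).
- by move=> s s1; have [G M ->] := FP (size s); rewrite // (bar_norm M).
- move=> s1 s2 i a x y; have [G M FG] := FP (size (s1 ++ hmk x :: s2)).
  by rewrite !FG ?(mor_lin M) // !size_cat.
- by move=> s e ne; have [G M ->] := FP (size s); rewrite // (mor_supp M).
- by have [G M ->] := FP 0; rewrite // (mor_nil M).
- by move=> i x; have [G M ->] := FP 1; rewrite // (mor_proj M).
- move=> s _; have [G M FG] := FP (size s).
  rewrite FG // (mor_eq M) //; apply: eq_twisting => v vs; by rewrite FG.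
Qed.

(** * Uniqueness: the isotopy together with its homotopy *)

Variables (b' b'' : seq (homog H) -> tot H) (f' f'' : seq (homog H) -> tot A).
Hypotheses (M' : bar_model p predT b' f') (M'' : bar_model p predT b'' f'').

Let rho (t : seq (homog H) -> tot H) : seq (homog H) -> tot A :=
  pullback (letter 1 t) f''.

(** Pullback along a coalgebra morphism preserves convolution, so f'' o t inherits the Maurer-Cartan
    equation up to the failure of t to commute with the coderivations. *)
Lemma tdiff_pullback t s : (0 < size s)%N ->
  (forall v, (0 < size v < size s)%N -> defect t b' b'' v = 0) ->
  tdiff (rho t s) =
  twisting b' (rho t) s - f'' [:: letter 2 (defect t b' b'') s].
Proof.
move=> s0 def0.
rewrite /rho /pullback (linear_blocks_sum _ _ (@tdiff_linear _ A)).
transitivity (pullback (letter 1 t) (twisting b'' f'') s).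
  by apply: eq_blocks_sum => c _; rewrite (mor_eq M'').
have -> : pullback (letter 1 t) (twisting b'' f'') s =
    pullback (letter 1 t) (ins (letter 2 b'') f'') s +
    - pullback (letter 1 t) (conv 1 1 (fun u => eps u *: f'' u) f'') s.
  rewrite /twisting -scaleN1r /pullback.
  rewrite (linear_blocks_sum (g := fun x => -1 *: x)); last first.
    by move=> a x y; exact: linearP.
  by rewrite -blocks_sumD; apply: eq_blocks_sum => c _; rewrite scaleN1r.
rewrite pullback_conv /twisting addrAC; congr (_ + _).
  rewrite (ins_pullback (bar_norm M'') (mor_lin M'') s0 def0).
  by rewrite addrK.
congr (- _); apply: eq_conv => // u; exact: pullback_eps.
Qed.

(** D lists the arities already settled, so that finite stages and the limit share one record. The
    linear part of t is left open; the equation in arity one determines it. *)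
Record bar_homotopy (D : pred nat) t eta : Prop := BarHomotopy {
  isot_lin : mlin t;
  isot_supp : supp 1 t;
  isot_nil : t [::] = 0;
  htpy_lin : mlin eta;
  htpy_supp : supp 0 eta;
  htpy_nil : eta [::] = 0;
  isot_eq : forall s, D (size s) -> defect t b' b'' s = 0;
  htpy_eq : forall s, D (size s) -> tdiff (eta s) = gauge b' f' (rho t) eta s }.

Lemma rho_nil t : rho t [::] = 0.
Proof. exact: mor_nil M''. Qed.

Lemma defect_supp t : supp 1 t -> supp 2 (defect t b' b'').
Proof.
move=> ts s e ne.
rewrite -[LHS]/(ins (letter 2 b') t s e - pullback (letter 1 t) b'' s e).
by rewrite (supp_ins b' ts) // (supp_pullback t (bar_supp M'')) // subrr.
Qed.

Lemma gauge_supp t eta : supp 0 eta -> supp 1 (gauge b' f' (rho t) eta).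
Proof.
move=> etas s e ne; rewrite -[LHS]/(- ins (letter 2 b') eta s e
  - conv 1 0 f' eta s e + conv 0 1 (fun u => eps u *: eta u) (rho t) s e
  - f' s e + rho t s e).
rewrite (supp_ins b' etas) // !supp_conv // (mor_supp M') //.
by rewrite /rho (supp_pullback t (mor_supp M'')) // !(oppr0, addr0).
Qed.

Lemma mlin_gauge t eta : mlin t -> mlin eta -> mlin (gauge b' f' (rho t) eta).
Proof.
move=> tlin etalin; have f'lin := mor_lin M'.
have rlin : mlin (rho t) by exact: (mlin_pullback tlin (mor_lin M'')).
apply: mlinD; last exact: rlin.
apply: mlinD; last exact: mlinN.
apply: mlinD; last by apply: mlin_conv rlin; exact: mlin_eps.
apply: mlinD; first exact/mlinN/mlin_ins/etalin/bar_lin/M'.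
exact/mlinN/mlin_conv.
Qed.

Lemma eq_defect t t' s : (forall v, (size v <= size s)%N -> t v = t' v) ->
  defect t b' b'' s = defect t' b' b'' s.
Proof.
by move=> tt; rewrite /defect (eq_pullback b'' tt) (eq_ins_letter (b' := b') _
  tt).
Qed.

Lemma eq_gauge t t' eta eta' s :
  (forall v, (size v <= size s)%N -> t v = t' v) ->
  (forall v, (size v <= size s)%N -> eta v = eta' v) ->
  gauge b' f' (rho t) eta s = gauge b' f' (rho t') eta' s.
Proof.
move=> tt ee; rewrite /gauge (eq_ins_letter (b' := b') _ ee) //.
rewrite /rho (eq_pullback f'' tt); congr (_ - _ + _ - _ + _).
  by apply: eq_cut => u v suv; rewrite ee // suv size_cat; lia.
apply: eq_cut => u v suv; rewrite ee; last by rewrite suv size_cat; lia.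
rewrite (eq_pullback f'' (f' := t')) // => w wv.
by apply: tt; rewrite suv size_cat; lia.
Qed.

(** Up to sign, f''_1 (defect) is the coboundary of the gauge expression; p sends it both to 0 and
    to the defect. *)
Lemma bar_homotopy_closed t eta n s : bar_homotopy (leq^~ n) t eta ->
  size s = n.+1 ->
  defect t b' b'' s = 0 /\ tdiff (gauge b' f' (rho t) eta s) = 0.
Proof.
move=> I sn.
have drho w : (size w <= n)%N -> tdiff (rho t w) = twisting b' (rho t) w.
  case: w => [|x w] wn.
    by rewrite /twisting ins_nil conv_nil ?rho_nil ?scaler0 // subrr tdiff0.
  rewrite tdiff_pullback //.
    by rewrite /letter (isot_eq I) // (mlin0 [::] [::] _ (mor_lin M'')) subr0.
  by move=> v /andP[_ vw]; rewrite (isot_eq I) //; apply: leq_trans wn;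
    exact: ltnW.
have dK : tdiff (gauge b' f' (rho t) eta s) =
    - f'' [:: letter 2 (defect t b' b'') s].
  apply: (tdiff_gauge (bar_norm M')).
  - exact: htpy_lin I.
  - exact: mor_nil M'.
  - exact: rho_nil.
  - exact: htpy_nil I.
  - by move=> w; apply: (proj1 (twisting_closed pP M' _)).
  - by move=> w; exact: mor_eq M' _ _.
  - by move=> w; rewrite sn ltnS; exact: drho.
  - apply: tdiff_pullback => [|v]; first by rewrite sn.
    by rewrite sn ltnS => /andP[_ vn]; exact: isot_eq I _ _.
  - by move=> w; rewrite sn ltnS; exact: htpy_eq I _.
suff def0 : defect t b' b'' s = 0.
  by rewrite dK /letter def0 (mlin0 [::] [::] _ (mor_lin M'')) oppr0.
rewrite -(mor_letter s M'' (defect_supp (isot_supp I))).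
rewrite -[f'' _]opprK -dK -scaleN1r -(addr0 (_ *: _)) tproj_linear.
rewrite (tproj_tdiff pP) (linear_fun0 (tproj_linear p)).
by rewrite scaler0 addr0.
Qed.

Lemma bar_homotopy_step n t eta : bar_homotopy (leq^~ n) t eta ->
  exists t' eta', bar_homotopy (leq^~ n.+1) t' eta' /\
    forall s, (size s <= n)%N -> t' s = t s /\ eta' s = eta s.
Proof.
move=> I; pose K := gauge b' f' (rho t) eta.
(* Changing t by - y in length n + 1 changes [rho t] there by - f''_1 (y), which takes the class y
   out of K and leaves K' exact. *)
pose y s := tproj p (K s).
pose K' s := K s - f'' [:: letter 1 y s].
pose c s := if size s == n.+1 then - y s else 0.
pose g s := if size s == n.+1 then thom h (K' s) - eta s else 0.
have c0 s : (size s <= n)%N -> c s = 0.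
  by move=> sn; rewrite /c; case: eqP => // sE; move: sn; rewrite sE ltnn.
have g0 s : (size s <= n)%N -> g s = 0.
  by move=> sn; rewrite /g; case: eqP => // sE; move: sn; rewrite sE ltnn.
have Ksupp : supp 1 K by exact/gauge_supp/(htpy_supp I).
have Klin : mlin K by apply: mlin_gauge; [exact: isot_lin I|exact: htpy_lin I].
have ylin : mlin y by apply: mlin_linear Klin; exact: tproj_linear.
have ysupp : supp 1 y by move=> s e ne; rewrite /y /tproj Ksupp ?linear0.
have flin : mlin f'' := mor_lin M''.
have K'lin : mlin K'.
  apply: mlinD => //; apply: mlinN.
  exact: (mlin_letter 1 [::] [::] ylin flin).
have K'supp : supp 1 K'.
  move=> s e ne; rewrite /K' -[LHS]/(K s e - f'' [:: letter 1 y s] e).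
  by rewrite Ksupp // (mor_supp M'') ?subr0 // /dg degs_cons degs_nil subrr
    !addr0.
have rhoE s : size s = n.+1 ->
    rho (fun v => t v + c v) s = rho t s - f'' [:: letter 1 y s].
  move=> sn; rewrite /rho (pullback_perturb _ flin); [|by rewrite sn|].
    rewrite /letter /c sn eqxx; congr (_ + _).
    have := flin [::] [::] _ (-1) (y s (dg 1 s)) 0.
    by rewrite /= !scaleN1r addr0 (mlin0 [::] [::] _ flin) addr0.
  by move=> v; rewrite sn; exact: c0.
have K'E s : size s = n.+1 ->
    gauge b' f' (rho (fun v => t v + c v)) (fun v => eta v + g v) s = K' s.
  move=> sn; rewrite /gauge rhoE // /K' /K /gauge addrA;
    congr (_ - _ + _ - _ + _ - _).
  - congr (- _); apply: eq_ins => v; rewrite sn ltnS => vn _.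
    by rewrite g0 // addr0.
  - apply: eq_convr; last exact: mor_nil M'.
    by move=> v; rewrite sn ltnS => vn; rewrite g0 // addr0.
  - rewrite (@eq_convl _ _ _ _ _ _ (fun u => eps u *: eta u)).
    + apply: eq_convr; last by rewrite (htpy_nil I) scaler0.
      move=> v; rewrite sn ltnS => vn; apply: eq_pullback => w wv.
      by rewrite c0 ?addr0 //; exact: leq_trans wv vn.
    + by move=> v; rewrite sn ltnS => vn; rewrite g0 // addr0.
    + exact: rho_nil.
exists (fun v => t v + c v), (fun v => eta v + g v); split; last first.
  by move=> s sn; rewrite c0 // g0 // !addr0.
split.
- by apply: mlinD; [exact: isot_lin I|exact/mlin_at_length/mlinN].
- move=> s e ne; rewrite -[LHS]/(t s e + c s e) (isot_supp I) // add0r /c.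
  by case: ifP => // _; rewrite -[LHS]/(- (y s e)) ysupp ?oppr0.
- by rewrite (isot_nil I) c0 ?addr0.
- apply: mlinD; first exact: htpy_lin I.
  apply/mlin_at_length/mlinD; last exact/mlinN/(htpy_lin I).
  by apply: mlin_linear K'lin; exact: thom_linear.
- move=> s e ne; rewrite -[LHS]/(eta s e + g s e) (htpy_supp I) // add0r /g.
  case: ifP => // _; rewrite -[LHS]/(thom h (K' s) e - eta s e) (htpy_supp I)
    // subr0.
  rewrite /thom K'supp ?linear0 //.
  by apply: contra ne => /eqP E; apply/eqP; move: E; rewrite /dg; lia.
- by rewrite (htpy_nil I) g0 ?addr0.
- move=> s; rewrite leq_eqVlt => /orP[/eqP sn|sn].
    (* The correction does not move the defect at this length: [ins] evaluates t on shorter words,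
       and the one-block term is b'' of a single letter, hence zero. *)
    have [<- _] := bar_homotopy_closed I sn.
    rewrite /defect (@eq_ins _ _ _ _ _ t) => [|v]; last first.
      by rewrite sn ltnS => vn _; rewrite c0 // addr0.
    congr (_ - _); rewrite (pullback_perturb _ (bar_lin M''));
      [|by rewrite sn|].
      by rewrite (bar_norm M'') // addr0.
    by move=> v; rewrite sn; exact: c0.
  rewrite -[RHS](isot_eq I (s := s)) //; apply: eq_defect => v vs.
  by rewrite c0 ?addr0 //; exact: leq_trans vs sn.
- move=> s; rewrite leq_eqVlt => /orP[/eqP sn|sn].
    have [_ dK] := bar_homotopy_closed I sn.
    rewrite K'E // /g sn eqxx addrC subrK.
    have M1 : predT (1%N) by [].
    apply: (tdiff_thom pP hP).
      by rewrite /K' tdiffD tdiffN dK (tdiff_letter 1 s y M'') // subrr.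
    have := tproj_linear p (-1) (f'' [:: letter 1 y s]) (K s).
    rewrite !scaleN1r (mor_letter s M'' ysupp) -/(y s) addNr.
    by rewrite /K' [K s - _]addrC.
  rewrite g0 // addr0 (htpy_eq I) //; apply: eq_gauge => v vs.
    by rewrite c0 ?addr0 //; exact: leq_trans vs sn.
  by rewrite g0 ?addr0 //; exact: leq_trans vs sn.
Qed.

Lemma bar_homotopy_exists : exists t eta, bar_homotopy predT t eta.
Proof.
(* Both maps start at zero in arity 0; even the linear part of t is produced by the inductive
   step. *)
have init : bar_homotopy (leq^~ 0%N) (fun=> 0) (fun=> 0).
  split=> //.
  - by move=> s1 s2 i a x y; rewrite scaler0 addr0.
  - by move=> s1 s2 i a x y; rewrite scaler0 addr0.
  - move=> [] // _; rewrite /defect ins_nil sub0r.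
    by rewrite -[pullback _ _ _]/(b'' [::]) (bar_norm M'') // oppr0.
  - move=> [] // _; rewrite /gauge ins_nil !conv_nil ?scaler0 ?(mor_nil M') //.
    by rewrite rho_nil !(oppr0, addr0) tdiff0.
have [||F FP] := @word_recursion (homog H) (tot H * tot A)
  (fun n F => bar_homotopy (leq^~ n) (fun s => (F s).1) (fun s => (F s).2)).
- by exists (fun s => (0, 0)).
- move=> n F /bar_homotopy_step [t [eta [I te]]].
  exists (fun s => (t s, eta s)) => // s sn.
  by have [-> ->] := te s sn; case: (F s).
exists (fun s => (F s).1), (fun s => (F s).2); split.
- move=> s1 s2 i a x y; have [G I FG] := FP (size (s1 ++ hmk x :: s2)).
  by rewrite !FG ?(isot_lin I) // !size_cat.
- by move=> s e ne; have [G I ->] := FP (size s); rewrite // (isot_supp I).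
- by have [G I ->] := FP 0; rewrite // (isot_nil I).
- move=> s1 s2 i a x y; have [G I FG] := FP (size (s1 ++ hmk x :: s2)).
  by rewrite !FG ?(htpy_lin I) // !size_cat.
- by move=> s e ne; have [G I ->] := FP (size s); rewrite // (htpy_supp I).
- by have [G I ->] := FP 0; rewrite // (htpy_nil I).
- move=> s _; have [G I FG] := FP (size s).
  by rewrite -[RHS](isot_eq I (s := s)) //; apply: eq_defect => v vs;
    rewrite FG.
- move=> s _; have [G I FG] := FP (size s).
  by rewrite FG // (htpy_eq I) //; apply: eq_gauge => v vs; rewrite FG.
Qed.

(** In arity one the homotopy equation reads
    [d eta(x) = f'' (t x) - f' x], so that t x and x are cohomologous. *)
Lemma bar_homotopy_linear_part t eta i (x : H i) :
  bar_homotopy predT t eta -> t [:: hmk x] i = x.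
Proof.
move=> I; have := htpy_eq I (s := [:: hmk x]) isT.
have dg1 : dg 1 [:: hmk x] = i by rewrite /dg degs_cons degs_nil subrr !addr0.
have conv1 q q' (u v : seq (homog H) -> tot A) : u [::] = 0 -> v [::] = 0 ->
    conv q q' u v [:: hmk x] = 0.
  move=> u0 v0; rewrite /conv cut_cons cut_nil u0 v0.
  rewrite (linear_fun0 (pmul_linearr _ _ _)).
  by rewrite (linear_fun0 (pmul_linearl _ _ _)) addr0.
rewrite /gauge ins1 !conv1 ?(mor_nil M') ?(htpy_nil I) ?rho_nil ?scaler0 //.
rewrite !(oppr0, add0r) => /(congr1 (tproj p)).
rewrite (tproj_tdiff pP) -scaleN1r tproj_linear scaleN1r.
rewrite -[rho t _]/(f'' [:: letter 1 t [:: hmk x]]).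
rewrite (mor_letter _ M'' (isot_supp I)) => /(congr1 (fun z : tot H => z i)).
rewrite -[X in _ = X -> _]/(- p i (f' [:: hmk x] i) + t [:: hmk x] i).
by rewrite (mor_proj M') addrC => /esym/eqP; rewrite subr_eq0 => /eqP.
Qed.

End BarExistence.

(** * Translation between signed A-infinity relations and the bar form *)

Lemma cut_nat (T : Type) (X : nmodType) (P : seq T -> seq T -> X) s :
  cut P s = \sum_(0 <= a < (size s).+1) P (take a s) (drop a s).
Proof.
elim: s P => [|x s IHs] P; first by rewrite cut_nil big_nat1.
rewrite cut_cons IHs [RHS]big_nat_recl //.
Qed.

(** The arity m is determined by l, so the sum runs over the start a = i - 1 and the length l of the
    block; [l < n] encodes m >= 2. *)
Lemma sum_insertion_positions (X : nmodType) (n : nat) (G : nat -> nat -> X) :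
  \sum_(2 <= m < n.+1) \sum_(2 <= l < n.+1 | (m + l == n.+1)%N)
    \sum_(1 <= i < m.+1) G i l =
  \sum_(0 <= a < n.+1) \sum_(0 <= l < (n - a).+1)
    if (1 < l < n)%N then G a.+1 l else 0.
Proof.
pose F m l a := if [&& 1 < m, 1 < l, m + l == n.+1 & a < m]%N
  then G a.+1 l else 0.
transitivity (\sum_(0 <= m < n.+1) \sum_(0 <= l < n.+1)
    \sum_(0 <= a < n.+1) F m l a).
  rewrite (big_nat_widenl 2 0) // big_mkcond; apply: eq_big_nat =>
    m /andP[_ mn].
  case: ifP => /= m2; last first.
    by symmetry; apply: big1 => l _; apply: big1 => a _; rewrite /F m2.
  rewrite (big_nat_widenl 2 0) // big_mkcond; apply: eq_bigr => l _.
  case: ifP => [/andP[ml l2]|lF]; last first.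
    symmetry; apply: big1 => a _; rewrite /F m2 /=.
    by move: lF; case: (1 < l)%N => /=; case: (_ == _).
  rewrite big_add1 /= (big_nat_widen 0 m n.+1) ?big_mkcond; last exact: ltnW.
  by apply: eq_bigr => a _; rewrite /F m2 l2 ml.
rewrite exchange_big /=; under eq_bigr do rewrite exchange_big /=.
rewrite exchange_big /=; apply: eq_big_nat => a /andP[_ an].
rewrite [RHS](big_nat_widen 0 _ n.+1); last by lia.
rewrite [RHS]big_mkcond.
apply: eq_big_nat => l /andP[_ ln].
have [cl|ncl] := boolP [&& (1 < l < n)%N & (l < (n - a).+1)%N]; last first.
  rewrite big1_seq => [|m]; last first.
    rewrite mem_index_iota /F => /andP[_ mn]; case: ifP => // /and4P[? ? ? ?];
      lia.
  by case: ifP => //; case: ifP => //; lia.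
have mI : (n.+1 - l)%N \in index_iota 0 n.+1 by rewrite mem_index_iota; lia.
rewrite (bigD1_seq _ mI) ?iota_uniq //= big1 => [|m ne]; last first.
  by rewrite /F; case: ifP => // /and4P[? ? ? ?]; lia.
rewrite addr0 /F; case/andP: cl => cl la; rewrite la cl.
by case: ifP => // /negP[]; apply/and4P; split; lia.
Qed.

Section BarTransform.
Variables (k : fieldType) (V : graded k).
Implicit Types s u v : seq (homog V).

(** The exponent of the Koszul sign of the n-fold desuspension; it turns the
    signs of the A-infinity relations into [eps]. *)
Fixpoint kappa s : int :=
  if s is x :: s' then (size s')%:Z * (tag x + 1) + kappa s' else 0.

Lemma kappa_cat s u :
  kappa (s ++ u) = kappa s + kappa u + (size u)%:Z * (degs s + (size s)%:Z).
Proof.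
elim: s => [|x s IHs] /=; first by rewrite degs_nil; ring.
rewrite IHs degs_cons size_cat -addn1 !PoszD; ring.
Qed.

Definition sgn s : k := (-1) ^ kappa s.

Lemma sgnK s : sgn s * sgn s = 1.
Proof. exact: signzK. Qed.

Lemma sgn1 x : sgn [:: x] = 1.
Proof. by rewrite /sgn /= mul0r addr0 expr0z. Qed.

Lemma kappa_mid i (x y : V i) s1 s2 :
  kappa (s1 ++ hmk x :: s2) = kappa (s1 ++ hmk y :: s2).
Proof. by rewrite !kappa_cat. Qed.

(** The cutoff discards meaningless values: m = 1 for structure operations, m = 0 for morphisms. For
    a morphism, m = 1 leaves out its linear part. *)
Definition bar (W : graded k) m (f : seq (homog V) -> forall e, W e)
    s : tot W :=
  if (m < size s)%N then sgn s *: (f s : tot W) else 0.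

Lemma mlin_bar (W : graded k) q m (f : ops q V W) : mlin (bar m f).
Proof.
move=> s1 s2 i a x y; rewrite /bar !size_cat /=.
case: ifP => _; last by rewrite scaler0 addr0.
rewrite /sgn (kappa_mid x (a *: x + y)) (kappa_mid y (a *: x + y)).
rewrite scalerA mulrC -scalerA -scalerDr; congr (_ *: _).
by apply: totP => e; exact: ops_linear.
Qed.

Lemma bar_supp_ops (W : graded k) q m c (f : ops q V W) :
  (forall n, q n = c - n%:Z) -> supp c (bar m f).
Proof.
move=> qc s e ne; rewrite /bar; case: ifP => // _.
by rewrite -[LHS]/(sgn s *: f s e) opsP ?scaler0 // qc.
Qed.

Lemma sgn_insertion u v t l (y : homog V) :
  l = size v -> tag y = dg 2 v ->
  (-1) ^+ ((size u).+1 * l.+1 + size (u ++ v ++ t)) *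
    (-1) ^ (mu_deg l * degs u) =
  - (sgn (u ++ v ++ t) * (eps u * (sgn (u ++ y :: t) * sgn v))) :> k.
Proof.
move=> -> ty; rewrite exprnP -!signzD -signzS.
pose a := (size u)%:Z; pose l' := (size v)%:Z; pose c := (size t)%:Z.
(* Half the sum of the two exponents, after expanding [kappa] by [kappa_cat]. *)
apply: (@signz_eq _ _ _ (kappa u + kappa v + kappa t + degs u * (c + 2)
  + degs v * c + a * (l' + c + 1) + 2 * c + l' + 1)).
rewrite !kappa_cat /= ty /dg /mu_deg !size_cat /=.
rewrite -(addn1 (size u)) -(addn1 (size v)) -(addn1 (size t)) !PoszD !PoszM
  !PoszD -/a -/l' -/c; ring.
Qed.

End BarTransform.

Section OpsTheory.
Variables (k : fieldType) (V W : graded k) (q : nat -> int) (f : ops q V W).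

Lemma ops0 s1 s2 i e : f (s1 ++ hmk (0 : V i) :: s2) e = 0.
Proof.
apply: (linear_fun0 (g := fun x : V i => f (s1 ++ hmk x :: s2) e)) => a x y.
exact: ops_linear.
Qed.

Lemma opsZ s1 s2 i a (x : V i) e :
  f (s1 ++ hmk (a *: x) :: s2) e = a *: f (s1 ++ hmk x :: s2) e.
Proof.
have := ops_linear f s1 s2 a x 0 e.
by rewrite addr0 ops0 addr0.
Qed.

End OpsTheory.

Section InsertionTranslation.
Variables (k : fieldType) (V W : graded k) (q : nat -> int).
Variables (f : ops q V W) (g : ops mu_deg V V).
Implicit Types s u v : seq (homog V).

(** The cutoff in [bar 1 f] matches the condition m >= 2 on the outer operation. *)
Lemma insertion_sum_bar s e :
  insertion_sum f g s e =
  - (sgn s *: ins (letter 2 (bar 1 g)) (bar 1 f) s e).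
Proof.
rewrite /insertion_sum sum_insertion_positions.
rewrite (linear_ins _ _ _ (@tot_eval_linear _ W e)) /ins -scaleNr cutZ cut_nat.
apply: eq_big_nat => a /andP[_ an].
rewrite /head_ins cutZ cutZ cut_nat size_drop; apply: eq_big_nat =>
  l /andP[_ ln].
set u := take a s; set v := take l _; set t := drop l _.
have sE : s = u ++ v ++ t by rewrite !cat_take_drop.
have su : size u = a by rewrite size_takel.
have sv : size v = l by rewrite size_takel // size_drop.
rewrite sv /=; case: ltnP => l1 /=; last by rewrite !scaler0.
case: ltnP => ls; last first.
  rewrite /bar ifF ?[(0 : tot W) e]/0 ?scaler0 //.
  apply/negbTE; rewrite -leqNgt size_cat /=; move: ls; rewrite sE !size_cat sv;
    lia.
have tE : drop (a + l) s = t by rewrite /t drop_drop addnC.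
rewrite tE -/v /bar ifT; last first.
  by rewrite size_cat /=; move: ls; rewrite sE !size_cat sv; lia.
set y := letter 2 _ v.
have -> : (sgn (u ++ y :: t) *: (f (u ++ y :: t) : tot W)) e =
  sgn (u ++ y :: t) *: f (u ++ y :: t) e by [].
have -> : f (u ++ y :: t) e = sgn v *: f (u ++ ops_val g v :: t) e.
  have -> : y = hmk (sgn v *: g v (dg 2 v)) by rewrite /y /letter /bar sv l1.
  exact: opsZ.
rewrite !scalerA; congr (_ *: _).
have := sgn_insertion u t (y := y) (esym sv) erefl.
by rewrite -sE su => ->; rewrite !mulNr !mulrA.
Qed.

End InsertionTranslation.

Section BlocksTuples.
Variables (T : Type) (X : nmodType).

Fixpoint blocks_of_number (m : nat) (G : seq (seq T) -> X) (s : seq T) : X :=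
  if m is m'.+1 then
    cut (fun u v => if u is [::] then 0 else
         blocks_of_number m' (fun c => G (u :: c)) v) s
  else if s is [::] then G [::] else 0.

Lemma eq_blocks_of_number m G G' s :
  (forall c, flatten c = s -> size c = m -> all (fun u => 0 < size u)%N c ->
     G c = G' c) ->
  blocks_of_number m G s = blocks_of_number m G' s.
Proof.
elim: m G G' s => [|m IHm] G G' s GG /=; first by case: s GG => // ->.
apply: eq_cut => -[|x u] v // suv; apply: IHm => c cv cm c0.
by apply: GG => //=; rewrite ?cv ?cm.
Qed.

Lemma blocks_sum_number G s M : (size s < M)%N ->
  blocks_sum G s = \sum_(0 <= m < M) blocks_of_number m G s.
Proof.
elim: M s G => // M IHM s G sM; rewrite big_nat_recl //=.
case: s sM => [|x s] sM.
  rewrite big1 ?addr0 // => m _; exact: cut_nil.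
rewrite add0r blocks_sumE //.
transitivity (cut (fun u v => \sum_(0 <= m < M) if u is [::] then 0 else
    blocks_of_number m (fun c => G (u :: c)) v) (x :: s)).
  apply: eq_cut => -[|y u] v suv; first by rewrite big1.
  by apply: IHM; move: sM; rewrite suv size_cat /=; lia.
by rewrite /cut exchange_big.
Qed.

(** Induction on m, the first entry of the tuple being the length of the first block. N is
    independent of [size s] so that the ordinal type stays fixed when passing to the rest of the
    word. *)
Lemma sum_tuple_blocks m N (G : seq (seq T) -> X) s : (size s <= N)%N ->
  \sum_(r : m.-tuple 'I_N.+1 |
      [forall j, 0 < tnth r j]%N && (\sum_(j < m) tnth r j == size s)%N)
    G (reshape [seq nat_of_ord x | x <- r] s) =
  blocks_of_number m G s.
Proof.
elim: m G s => [|m IHm] G s sN.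
  case: s sN => [|x s] sN /=; last first.
    by rewrite big_pred0 // => r; rewrite big_ord0 andbF.
  rewrite (big_pred1 [tuple]) // => r.
  rewrite (tuple0 r) [RHS]eqxx; apply/andP; split; last by rewrite big_ord0.
  by apply/forallP => -[].
pose h (p : 'I_N.+1 * m.-tuple 'I_N.+1) : m.+1.-tuple 'I_N.+1 :=
  [tuple of p.1 :: p.2].
have hbij : bijective h.
  exists (fun t => (thead t, [tuple of behead t])).
    by move=> [a r]; congr (_, _); apply: val_inj.
  by move=> t; rewrite [RHS]tuple_eta; apply: val_inj.
rewrite (reindex h) /=; last exact/onW_bij.
pose F (a : 'I_N.+1) (r : m.-tuple 'I_N.+1) :=
  G (reshape [seq nat_of_ord x | x <- h (a, r)] s).
rewrite -(pair_big_dep xpredT (fun a r => [forall j, 0 < tnth (h (a, r)) j]%N &&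
  (\sum_(j < m.+1) tnth (h (a, r)) j == size s)%N) F) /=.
rewrite cut_nat (big_nat_widen 0 _ N.+1) ?ltnS // big_mkord.
rewrite [RHS]big_mkcond.
apply: eq_bigr => a _.
have condE r : [forall j, 0 < tnth (h (a, r)) j]%N &&
    (\sum_(j < m.+1) tnth (h (a, r)) j == size s)%N =
    [&& (0 < a)%N, (a <= size s)%N & [forall j, 0 < tnth r j]%N &&
      (\sum_(j < m) tnth r j == size (drop a s))%N].
  rewrite big_ord_recl tnth0 size_drop.
  under eq_bigr do rewrite tnthS.
  have -> : [forall j, 0 < tnth (h (a, r)) j]%N =
      (0 < a)%N && [forall j, 0 < tnth r j]%N.
    apply/forallP/andP => [a0|[a0 /forallP r0] j].
      split; first by have := a0 ord0; rewrite tnth0.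
      by apply/forallP => j; have := a0 (lift ord0 j); rewrite tnthS.
    by case: (unliftP ord0 j) => [j'|] ->; rewrite ?tnthS ?tnth0.
  case: (0 < a)%N => //=; case: [forall j, _] => /=; last by rewrite andbF.
  by apply/eqP/andP => [<-|[ale /eqP ->]]; [split; [|apply/eqP]|]; lia.
under eq_bigl do rewrite condE.
rewrite ltnS; case: ltnP => a0; last first.
  rewrite big1 //; move: a0; rewrite leqn0 => /eqP ->.
  by rewrite leq0n take0.
case: leqP => ale /=; last by rewrite big1.
rewrite -(IHm (fun c => G (take a s :: c)) (drop a s)); last first.
  by rewrite size_drop; lia.
case E : (take a s) => [|x u]; last by rewrite -E.
by move: (size_takel ale); rewrite E /= => aE; move: a0; rewrite -aE.
Qed.

End BlocksTuples.

Fixpoint pair_sum (T : Type) (X : nmodType) (F : T -> T -> X) (c : seq T) : X :=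
  if c is u :: c' then \sum_(v <- c') F u v + pair_sum F c' else 0.

Lemma pair_sumE (T : Type) (X : nmodType) (F : T -> T -> X) x0 (c : seq T) :
  \sum_(j < size c) \sum_(i < size c | (i < j)%N) F (nth x0 c i) (nth x0 c j) =
  pair_sum F c.
Proof.
elim: c => [|u c IHc] /=; first by rewrite big_ord0.
rewrite big_ord_recl big1 // add0r.
rewrite -IHc (big_nth x0) big_mkord -big_split; apply: eq_bigr => j _ /=.
rewrite big_mkcond big_ord_recl /=; congr (_ + _).
by rewrite [RHS]big_mkcond.
Qed.

Section CompositionTranslation.
Variables (k : fieldType) (V W X : graded k).
Variables (g : ops mu_deg W X) (f : ops theta_deg V W).
Implicit Types s u v : seq (homog V).
Implicit Types c : seq (seq (homog V)).

Let len_sum c : nat := pair_sum (fun u v => size u * (size v).+1)%N c.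
Let deg_sum c : int := pair_sum (fun u v => theta_deg (size v) * degs u) c.

Let len_sumE u c :
  len_sum (u :: c) = (size u * (size (flatten c) + size c) + len_sum c)%N.
Proof.
rewrite /len_sum /=; congr (_ + _)%N.
elim: c => [|v c IHc]; first by rewrite big_nil muln0.
by rewrite big_cons IHc /= size_cat; lia.
Qed.

Let deg_sumE u c :
  deg_sum (u :: c) =
  degs u * ((size c)%:Z - (size (flatten c))%:Z) + deg_sum c.
Proof.
rewrite /deg_sum /=; congr (_ + _).
elim: c => [|v c IHc]; first by rewrite big_nil subrr mulr0.
by rewrite big_cons IHc /= size_cat -addn1 !PoszD /theta_deg; ring.
Qed.

Let kappa_sum c : int := \sum_(u <- c) kappa u.

Let F := letter 1 (bar 0 f).

(** The two exponents in [composition_sum] balance modulo 2 with [kappa] of the word, of its blocks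
    and of the word of their values; z is built up block by block. *)
Let composition_sign c :
  exists z, (len_sum c)%:Z + deg_sum c +
    (kappa (flatten c) + (kappa (map F c) + kappa_sum c)) = z + z.
Proof.
elim: c => [|u c [z IHc]].
  by exists 0; rewrite /kappa_sum big_nil.
exists (z + kappa u + degs u * (size c)%:Z + (size u)%:Z * (size (flatten c))%:Z
  + (size c)%:Z).
rewrite len_sumE deg_sumE /kappa_sum big_cons -/(kappa_sum c) /= kappa_cat.
rewrite size_map /dg PoszD PoszM PoszD.
move: IHc; move: (len_sum c)%:Z (deg_sum c) (kappa (flatten c)) => a1 a2 a3.
move: (kappa (map F c)) (kappa_sum c) => a4 a5 IHc.
have -> : a1 = z + z - a2 - (a3 + (a4 + a5)) by rewrite -IHc; ring.
ring.
Qed.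

(** The prefix y holds the letters already stripped of their signs, which makes the induction go
    through. *)
Let ops_bar_letters (y : seq (homog W)) c e :
  all (fun u => 0 < size u)%N c ->
  g (y ++ map F c) e = (-1) ^ kappa_sum c *: g (y ++ map (ops_val f) c) e.
Proof.
elim: c y => [|u c IHc] y /=; first by rewrite /kappa_sum big_nil scale1r.
case/andP=> u0 c0; rewrite /kappa_sum big_cons -/(kappa_sum c) signzD.
have -> : F u = hmk (sgn u *: f u (dg 1 u)) by rewrite /F /letter /bar u0.
rewrite opsZ -scalerA; congr (_ *: _).
by rewrite -!cat_rcons IHc.
Qed.

Lemma composition_sum_bar s e :
  composition_sum g f s e =
  sgn s *: pullback (letter 1 (bar 0 f)) (bar 1 g) s e.
Proof.
rewrite /pullback (linear_blocks_sum _ _ (@tot_eval_linear _ X e)).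
rewrite (linear_blocks_sum (g := fun x : X e => sgn s *: x)); last first.
  by move=> a x y; exact: linearP.
rewrite (blocks_sum_number _ (leqnn (size s).+1)).
(* Fewer than two blocks are killed by [bar 1 g], in accordance with m >= 2 in [composition_sum]. *)
have small m : (m <= 1)%N -> blocks_of_number m (fun c =>
    sgn s *: bar 1 g (map (letter 1 (bar 0 f)) c) e) s = 0.
  move=> m1; rewrite (@eq_blocks_of_number _ _ m _ (fun=> 0)); last first.
    move=> c _ cm _; rewrite /bar size_map cm ltnNge m1.
    exact: scaler0.
  case: m m1 => [|[|m]] // _ /=; first by case: (s).
  by apply: cut0 => -[|x u] [|y v].
rewrite (big_cat_nat (n := minn 2 (size s).+1)) //= ?geq_minr //.
rewrite big_nat big1 ?add0r => [|m /andP[_ m2]]; last by apply: small; lia.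
rewrite /composition_sum; case: (ltnP (size s) 1%N) => s1.
  by rewrite !big_geq //; lia.
rewrite (minn_idPl _) //.
apply: eq_big_nat => m /andP[m2 _].
rewrite -(sum_tuple_blocks m _ (leqnn (size s))).
apply: eq_bigr => r /andP[/forallP r0 /eqP rs].
set sh := [seq nat_of_ord x | x <- r]; set c := reshape sh s.
have shs : sumn sh = size s.
  by rewrite -rs sumnE big_map big_tuple.
have shc : shape c = sh by apply: reshapeKl; rewrite shs.
have fc : flatten c = s by apply: reshapeKr; rewrite shs.
have cm : size c = m by rewrite -(size_map size) -/(shape c) shc size_map
  size_tuple.
have c0 : all (fun u => 0 < size u)%N c.
  rewrite -(all_map size (fun n => 0 < n)%N) -/(shape c) shc all_map.
  by apply/allP => x /tnthP[j ->]; exact: r0.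
have rE (j : 'I_m) : tnth r j = size (nth [::] c j) :> nat.
  rewrite -(nth_map [::] 0%N size) ?cm // -/(shape c) shc.
  by rewrite (nth_map ord0) ?size_tuple // -tnth_nth.
have -> : (\sum_(j < m) \sum_(i < m | (i < j)%N) tnth r i * (tnth r j).+1)%N =
    len_sum c.
  rewrite /len_sum -(pair_sumE _ [::]) cm; apply: eq_bigr => j _.
  by apply: eq_bigr => i _; rewrite !rE.
have -> : \sum_(j < m) \sum_(i < m | (i < j)%N)
    theta_deg (tnth r j) * degs (nth [::] c i) = deg_sum c.
  rewrite /deg_sum -(pair_sumE _ [::]) cm; apply: eq_bigr => j _.
  by apply: eq_bigr => i _; rewrite !rE.
rewrite /bar size_map cm m2 -/(bar 0 f) -/F.
have -> : (sgn (map F c) *: (g (map F c) : tot X)) e =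
  sgn (map F c) *: g (map F c) e by [].
rewrite (ops_bar_letters [::]) // !scalerA; congr (_ *: _).
have [z cz] := composition_sign c.
rewrite exprnP -fc /sgn -mulrA -!signzD; exact: signz_eq cz.
Qed.

End CompositionTranslation.

Section ProductTranslation.
Variables (k : fieldType) (V : graded k) (A : dga k).
Implicit Types s u v : seq (homog V).

Lemma blocks_sum_pairs (Y : zmodType) (G : seq (seq (homog V)) -> Y) s :
  (forall c, size c != 2%N -> G c = 0) ->
  blocks_sum G s = cut (fun u v =>
    if (0 < size u)%N && (0 < size v)%N then G [:: u; v] else 0) s.
Proof.
move=> G0; case: s => [|x s]; first by rewrite cut_nil /= G0.
rewrite blocks_sumE //; apply: eq_cut => -[|y u] [|z v] _ //=.
  by rewrite G0.
rewrite -/(blocks_sum (fun c => G ((y :: u) :: c)) (z :: v)) blocks_sumE //.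
rewrite cut_last // => -[|a p] // [|d q] _ // _.
rewrite -[RHS](blocks_sum0 Y (d :: q)); apply: eq_blocks_sum => -[|c' c] //= _.
exact: G0.
Qed.

(** Only decompositions into two blocks u, v survive. For the word of their two values [kappa] is |f
    u| + 1 = dg 0 u + 2, which explains [eps u]. *)
Lemma pullback_product (f : seq (homog V) -> tot A) s : f [::] = 0 ->
  pullback (letter 1 f) (bar 1 (dga_mu A)) s =
  conv 1 1 (fun u => eps u *: f u) f s.
Proof.
move=> f0; rewrite /pullback blocks_sum_pairs; last first.
  move=> c c2; rewrite /bar size_map; case: ifP => // _.
  by apply: totP => e;
    rewrite -[LHS]/(_ *: dga_mu A _ e) dga_mu_neq2 ?size_map ?scaler0.
apply: eq_cut => -[|x u] v _.
  by rewrite f0 scaler0 (linear_fun0 (pmul_linearl _ _ _)).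
case: v => [|y v] /=; first by rewrite f0 (linear_fun0 (pmul_linearr _ _ _)).
rewrite (linear_funZ _ _ (pmul_linearl _ _ _)) /bar /=; congr (_ *: _).
rewrite /sgn /eps /= mul0r !addr0 mul1r.
by apply: (@signz_eq _ _ _ (dg 0 (x :: u) + 1)); rewrite /dg /=; lia.
Qed.

End ProductTranslation.

Section ZeroDifferential.
Variables (k : fieldType) (C : complex k).
Let H := coho_complex C.
Implicit Types s u v : seq (homog H).

Lemma delta_coho q (D : complex k) (f : ops q H D) s e :
  delta f s e = diff D e (f s e).
Proof.
rewrite /delta big1 ?scaler0 ?subr0 // => j _.
set x := tnth _ j.
have E : f (take j s ++ hdiff x :: drop j.+1 s) (e + 1) = 0.
  exact: (ops0 f _ _ (tag x + 1)).
by rewrite E scaler0.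
Qed.

(** Contracting all of s is the only way to reach a single letter; this is the term f_1 o mu_n,
    which the morphism equation lists apart from the insertion sum. *)
Lemma ins_bar01 (D : complex k) (M : ops mu_deg H H) (f : ops theta_deg H D) s :
  (1 < size s)%N ->
  ins (letter 2 (bar 1 M)) (bar 0 f) s =
  bar 0 f [:: letter 2 (bar 1 M) s] + ins (letter 2 (bar 1 M)) (bar 1 f) s.
Proof.
move=> s1; pose f1 w : tot D := if size w == 1%N then bar 0 f w else 0.
rewrite (@eq_ins _ _ _ _ (bar 0 f) (fun w => f1 w + bar 1 f w)); last first.
  by move=> [|x [|y w]] //= _ _; rewrite /f1 /bar /= ?addr0 ?add0r.
rewrite insD; congr (_ + _); case: s s1 => // x s s1.
rewrite ins_cons [X in _ *: X]cut0 => [|u v _]; last first.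
  rewrite [head_ins _ _ _]cut0 ?scaler0 // => t w _; case: ifP => // _.
  by rewrite /f1 /= size_cat addnS.
rewrite scaler0 addr0 /head_ins cut_last => [|u v suv v0]; last first.
  by case: ifP => // _; rewrite /f1 /= eqSS -leqn0 leqNgt v0.
by rewrite s1.
Qed.

Lemma morphism_eq_bar (D : complex k) (M : ainf H) (N : ainf D)
    (f : ops theta_deg H D) s e : (1 < size s)%N ->
  delta f s e + composition_sum N f s (e + 1) -
    (f [:: ops_val M s] (e + 1) - insertion_sum f M s (e + 1)) =
  sgn s *: (tdiff (bar 0 f s) +
    pullback (letter 1 (bar 0 f)) (bar 1 N) s -
    ins (letter 2 (bar 1 M)) (bar 0 f) s) (e + 1).
Proof.
move=> s1; rewrite delta_coho insertion_sum_bar composition_sum_bar.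
rewrite ins_bar01 // -[RHS]/(sgn s *: (tdiff (bar 0 f s) (e + 1) +
  pullback (letter 1 (bar 0 f)) (bar 1 N) s (e + 1) -
  (bar 0 f [:: letter 2 (bar 1 M) s] (e + 1) +
   ins (letter 2 (bar 1 M)) (bar 1 f) s (e + 1)))).
rewrite tdiffE opprK.
have -> : f s e = sgn s *: bar 0 f s e.
  rewrite /bar ltnW // -[X in _ = _ *: X]/(sgn s *: f s e).
  by rewrite scalerA sgnK scale1r.
have -> : f [:: ops_val M s] (e + 1) =
    sgn s *: bar 0 f [:: letter 2 (bar 1 M) s] (e + 1).
  have -> : letter 2 (bar 1 M) s = hmk (sgn s *: M s (dg 2 s)).
    by rewrite /letter /bar s1.
  rewrite /bar /= sgn1 scale1r (opsZ f [::] [::]) scalerA sgnK scale1r.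
  by [].
by rewrite linearZ /= -!scalerDr -scalerBr.
Qed.

(** The two equations differ by the invertible factor [sgn s], and letting e range over all degrees
    gives equality in [tot D]. *)
Lemma morphism_bar (D : complex k) (M : ainf H) (N : ainf D)
    (f : ops theta_deg H D) s : (1 < size s)%N ->
  (forall e, delta f s e + composition_sum N f s (e + 1) =
     f [:: ops_val M s] (e + 1) - insertion_sum f M s (e + 1)) <->
  tdiff (bar 0 f s) = ins (letter 2 (bar 1 M)) (bar 0 f) s -
     pullback (letter 1 (bar 0 f)) (bar 1 N) s.
Proof.
move=> s1; set T := tdiff _; set I := ins _ _ _; set P := pullback _ _ _.
have sgn0 : (sgn s == 0 :> k) = false.
  by rewrite expfz_eq0 oppr_eq0 oner_eq0 andbF.
split=> [E|E e]; last first.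
  apply/eqP; rewrite -subr_eq0 morphism_eq_bar // -/T -/I -/P E.
  by rewrite subrK subrr scaler0.
apply/eqP; rewrite -subr_eq0 opprB addrA; apply/eqP/totP => e.
rewrite -(subrK 1 e); have /eqP := E (e - 1).
rewrite -subr_eq0 morphism_eq_bar // scaler_eq0 sgn0 => /eqP.
by rewrite -/T -/I -/P.
Qed.

(** [sgn] is its own inverse, so the same factor undoes [bar]. The definition is transparent so that
    the values can be computed afterwards. *)
Definition unbar q c (qE : forall n, q n = c - n%:Z) (W : graded k)
    (f : seq (homog H) -> tot W) (flin : mlin f) (fs : supp c f) : ops q H W.
Proof.
exists (fun s e => sgn s *: f s e).
  move=> s1 s2 i a x y e; rewrite flin.
  rewrite /sgn (kappa_mid x (a *: x + y)) (kappa_mid y (a *: x + y)).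
  set z := (-1) ^ _; rewrite -[LHS]/(z *: (a *: f _ e + f _ e)).
  by rewrite scalerDr !scalerA mulrC.
by move=> s e; rewrite qE => ne; rewrite fs ?scaler0.
Defined.

Lemma bar_unbar q c (qE : forall n, q n = c - n%:Z) (W : graded k)
    (f : seq (homog H) -> tot W) (flin : mlin f) (fs : supp c f) m :
  (forall s, (size s <= m)%N -> f s = 0) -> bar m (unbar qE flin fs) = f.
Proof.
move=> f0; apply/funext => s; rewrite /bar; case: ltnP => [sm|/f0->//].
apply: totP => e; rewrite -[LHS]/(sgn s *: (sgn s *: f s e)).
by rewrite scalerA sgnK scale1r.
Qed.

End ZeroDifferential.

(** * Canonical minimal models and isotopies from their bar forms *)

Section MinimalModels.
Variables (k : fieldType) (A : dga k).
Let H := coho_complex A.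
Variable p : forall e, {linear A e -> H e}.
Hypothesis pP : forall e (z : cocycle A e), p e (cocycle_val z) = coho_class z.
Variable h : forall e, {linear A (e + 1) -> A e}.
Hypothesis hP : forall e y, diff A e (h e (diff A e y)) = diff A e y.
Implicit Types s u v : seq (homog H).

Lemma tdiff_coho (x : tot H) : tdiff x = 0.
Proof. by apply: totP => e; rewrite -(subrK 1 e) tdiffE. Qed.

Lemma mu_degE n : mu_deg n = 2 - n%:Z. Proof. by []. Qed.
Lemma theta_degE n : theta_deg n = 1 - n%:Z. Proof. by []. Qed.

Lemma linear_part_bar (W : graded k) (f : ops theta_deg H W) i (x : H i) :
  bar 0 f [:: hmk x] i = linear_part f x.
Proof. by rewrite /bar /= sgn1 scale1r. Qed.

Lemma bar_model_of (M : ainf H) (psi : ainf_morphism M (dga_ainf A)) :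
  (forall i (x : H i), represents (linear_part psi x) x) ->
  bar_model p predT (bar 1 M) (bar 0 psi).
Proof.
move=> psiP; have psi0 : bar 0 psi [::] = 0 by [].
split.
- exact: mlin_bar.
- exact: bar_supp_ops.
- by move=> s s1; rewrite /bar ltnNge s1.
- exact: mlin_bar.
- exact: bar_supp_ops.
- exact: psi0.
- by move=> i x; rewrite linear_part_bar; exact/(proj_represents pP).
(* The morphism equation starts at length two. The empty word is trivial, and length one holds
   because representatives are cocycles. *)
case=> [|[i x] [|y s]] _.
- by rewrite psi0 /twisting ins_nil conv_nil ?psi0 ?scaler0 // subrr tdiff0.
- rewrite twisting1 //; apply: totP => e; rewrite -(subrK 1 e) tdiffE.
  have [<-|ne] := eqVneq i (e - 1).
    by rewrite linear_part_bar (represents_diff (psiP _ _)).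
  rewrite (@bar_supp_ops _ _ _ theta_deg 0 1) ?linear0 //.
  by rewrite /dg degs_cons degs_nil subrr !addr0 eq_sym.
have := proj1 (morphism_bar M (dga_ainf A) psi (s := hmk x :: y :: s) isT).
rewrite pullback_product //; apply => e.
exact: thetaP.
Qed.

Lemma ainf_of_bar_model (b : seq (homog H) -> tot H) f :
  bar_model p predT b f ->
  exists2 M : ainf H, bar 1 M = b & canonical_minimal_model M.
Proof.
move=> B.
pose m := unbar mu_degE (bar_lin B) (bar_supp B).
have mb : bar 1 m = b by apply: bar_unbar; exact: bar_norm B.
have mP s e : (2 <= size s)%N -> delta m s e = insertion_sum m m s (e + 1).
  move=> s2; rewrite delta_coho insertion_sum_bar mb.
  have [-> _] := twisting_closed pP B (s := s) (fun _ _ => isT).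
  by rewrite [(0 : tot H) _]/0 scaler0 oppr0.
pose M := Ainf mP; exists M => //.
pose t := unbar theta_degE (mor_lin B) (mor_supp B).
have tf : bar 0 t = f.
  by apply: bar_unbar => s; rewrite leqn0 size_eq0 => /eqP ->; exact: mor_nil B.
have lt i (x : H i) : linear_part t x = f [:: hmk x] i.
  by rewrite -linear_part_bar tf.
have dt i (x : H i) : diff A i (linear_part t x) = 0.
  by rewrite lt -tdiffE (mor_eq B) // twisting1 //; exact: mor_nil B.
have t1P i (x : H i) : diff A i (linear_part t x) = linear_part t (diff H i x).
  by rewrite dt; symmetry; exact: (ops0 t [::] [::] (i + 1)).
have tP s e : (2 <= size s)%N ->
    delta t s e + composition_sum (dga_ainf A) t s (e + 1) =
    t [:: ops_val M s] (e + 1) - insertion_sum t M s (e + 1).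
  move=> s2; apply: (proj2 (morphism_bar M (dga_ainf A) t s2)) => {e}.
  rewrite tf [bar 1 M]mb pullback_product; last exact: mor_nil B.
  by rewrite (mor_eq B).
exists (AinfMorphism t1P tP) => i x.
exists (cocycle_of (dt i x)) => //.
rewrite -pP -[cocycle_val _]/(linear_part t x) lt; exact: mor_proj B _ _.
Qed.

Lemma isotopy_of_homotopy (M' M'' : ainf H)
    (psi' : ainf_morphism M' (dga_ainf A))
    (psi'' : ainf_morphism M'' (dga_ainf A)) :
  (forall i (x : H i), represents (linear_part psi' x) x) ->
  (forall i (x : H i), represents (linear_part psi'' x) x) ->
  exists f : ainf_morphism M' M'', isotopy f.
Proof.
move=> /bar_model_of B' /bar_model_of B''.
have [t [eta I]] := bar_homotopy_exists pP hP B' B''.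
pose f := unbar theta_degE (isot_lin I) (isot_supp I).
have ft : bar 0 f = t.
  by apply: bar_unbar => s; rewrite leqn0 size_eq0 => /eqP ->;
    exact: isot_nil I.
have f1P i (x : H i) : diff H i (linear_part f x) = linear_part f (diff H i x).
  by symmetry; exact: (ops0 f [::] [::] (i + 1)).
have fP s e : (2 <= size s)%N ->
    delta f s e + composition_sum M'' f s (e + 1) =
    f [:: ops_val M' s] (e + 1) - insertion_sum f M' s (e + 1).
  move=> s2; apply: (proj2 (morphism_bar M' M'' f s2)) => {e}.
  rewrite tdiff_coho ft; exact/esym/(isot_eq I).
exists (AinfMorphism f1P fP) => i x.
rewrite -linear_part_bar /= ft; exact: (bar_homotopy_linear_part pP B' B'' x I).
Qed.

End MinimalModels.

Theorem theorem2 (k : fieldType) (A : dga k) :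
  (exists M : ainf (coho_complex A), canonical_minimal_model M) /\
  (forall M' M'' : ainf (coho_complex A),
     canonical_minimal_model M' -> canonical_minimal_model M'' ->
     exists f : ainf_morphism M' M'', isotopy f).
Proof.
have [p pP] := coho_projection A.
have [h hP] := diff_homotopy A.
split.
  have [b [f B]] := bar_model_exists pP hP.
  by have [M _] := ainf_of_bar_model pP B; exists M.
by move=> M' M'' [psi' psi'P] [psi'' psi''P];
  exact: isotopy_of_homotopy psi'P psi''P.
Qed.
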